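(* Let $T$ be a tree with nullity $2$ that has no eigenvalue in $(0,1)\cup(1,2)$. Then either $T$ is the tree $Y$, or $T=S(p,q)$ for some nonnegative integers $p,q$.
   Context: Eigenvalues are adjacency eigenvalues; the nullity of a graph is the multiplicity of $0$ as an eigenvalue. $Y$ is the tree on $6$ vertices consisting of two adjacent vertices $u,w$, each of which has exactly two further neighbors that are leaves. For nonnegative integers $p,q$, let $C(p,q)$ be the tree obtained from the path $v_1v_2v_3v_4v_5$ by attaching $p$ new leaves to $v_2$ and $q$ new leaves to $v_4$; then $S(p,q)$ is obtained from $C(p,q)$ by attaching one new pendant vertex to each vertex of degree $1$ of $C(p,q)$ and one new pendant vertex to $v_3$. *)

(* Defs.v *)
From HB Require Import structures.
From mathcomp Require Import all_boot all_order all_algebra.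

Set Implicit Arguments.
Unset Strict Implicit.
Unset Printing Implicit Defensive.

Import Order.TTheory GRing.Theory Num.Theory.
Local Open Scope ring_scope.

Record sgraph := SGraph {
  vertex :> finType;
  adj : rel vertex;
  adj_sym : symmetric adj;
  adj_irr : irreflexive adj }.

(* Every edge {x, y} yields the degenerate ucycle [:: x; y], hence the bound
   on the size. *)
Definition acyclic (G : sgraph) : Prop :=
  forall c : seq G, ucycle (@adj G) c -> (size c < 3)%N.

Definition connected (G : sgraph) : Prop :=
  forall x y : G, connect (@adj G) x y.

Definition is_tree (G : sgraph) : Prop :=
  [/\ (0 < #|G|)%N, connected G & acyclic G].

Definition degree (G : sgraph) (x : G) : nat := #|[set y | adj x y]|.

Definition isomorphic (G H : sgraph) : Prop :=
  exists f : G -> H, bijective f /\ forall x y : G, adj (f x) (f y) = adj x y.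

Definition adjmx (R : nzRingType) (G : sgraph) : 'M[R]_#|G| :=
  \matrix_(i, j) (adj (enum_val i) (enum_val j))%:R.

Definition nullity (R : fieldType) (G : sgraph) : nat :=
  mup 0 (char_poly (adjmx R G)).

Section PathGraph.
Variable n : nat.

Definition path_adj : rel 'I_n :=
  fun i j => (i.+1 == j :> nat) || (j.+1 == i :> nat).

Fact path_adj_sym : symmetric path_adj.
Proof. by move=> i j; rewrite /path_adj orbC. Qed.

Fact path_adj_irr : irreflexive path_adj.
Proof. by move=> i; rewrite /path_adj orbb gtn_eqF. Qed.

Definition path_graph : sgraph := SGraph path_adj_sym path_adj_irr.
End PathGraph.

(* attach_leaves G m adds m x new leaves to each vertex x of G; the old
   vertices are the [inl x], the leaves at x are the [inr (Tagged _ k)]. *)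
Section AttachLeaves.
Variables (G : sgraph) (m : G -> nat).

Definition attach_adj : rel (G + {x : G & 'I_(m x)})%type :=
  fun a b => match a, b with
  | inl x, inl y => adj x y
  | inl x, inr l => x == tag l
  | inr l, inl y => tag l == y
  | inr _, inr _ => false
  end.

Fact attach_adj_sym : symmetric attach_adj.
Proof. by case=> [x|l] [y|k] //=; rewrite 1?adj_sym // eq_sym. Qed.

Fact attach_adj_irr : irreflexive attach_adj.
Proof. by case=> [x|l] //=; rewrite adj_irr. Qed.

Definition attach_leaves : sgraph := SGraph attach_adj_sym attach_adj_irr.
End AttachLeaves.

Definition Y_tree : sgraph := attach_leaves (fun _ : path_graph 2 => 2%N).

(* The vertex v_i of the path v_1 v_2 v_3 v_4 v_5 is the ordinal i - 1. *)
Definition C_mult (p q : nat) (i : path_graph 5) : nat :=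
  match val i with 1 => p | 3 => q | _ => 0 end%N.

Definition C_tree (p q : nat) : sgraph := attach_leaves (C_mult p q).

Definition C_v3 (p q : nat) : C_tree p q := inl (inord 2 : 'I_5).

Definition S_tree (p q : nat) : sgraph :=
  attach_leaves (fun x : C_tree p q =>
    ((degree x == 1) + (x == C_v3 p q))%N).

(* Main.v *)
(** Write [A] for the adjacency matrix and work on the two colour classes of the
    tree. The gap says that [A ^ 2] has eigenvalues [0], [1] or at least [4], so
    [|A f| >= |f|] for [f] orthogonal to the kernel (with equality only if
    [A ^ 2 f = f]) and [(A ^ 2 - 1) (A ^ 2 - 4)] is positive semidefinite. The
    kernel is the sum of its restrictions to the two classes, of dimensions
    [(0, 2)] or [(1, 1)], whose difference is that of the class sizes; moreover
    the degrees in each class add up to the number of edges.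

    If [A] is injective on a class, that class contains no leaf, hence by counting
    edges has one vertex [h] of degree three and otherwise vertices of degree two.
    Test vectors of small support show that the latter have a leaf neighbour and
    that [h] has exactly one, which gives [S(p, q)] with [v_3 = h].

    If the kernel splits as [(1, 1)], every leaf lies in its support, and two leaves
    of one class either share their neighbour or hang on two paths of length two
    from a common vertex. In the first case the degree count and the same test
    vectors give [Y]. If no two leaves of a class are twins, the degree count leaves
    so few branchings that the kernel vector of the opposite class, which vanishes
    next to the leaves, vanishes identically. *)

Require Import Defs.
From mathcomp Require Import all_boot all_order all_algebra.
From mathcomp Require Import complex ring lra zify.

Set Implicit Arguments.
Unset Strict Implicit.
Unset Printing Implicit Defensive.

Import Order.TTheory GRing.Theory Num.Theory.
Local Open Scope ring_scope.

(** * Symmetric matrices over a real closed field *)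

(** The basis vectors at the nonzero entries, collected as the rows of [U], span the same row space,
    and they are independent because [U^T] is a right inverse of [U]. *)
Lemma rank_diag_mx (F : fieldType) n (d : 'rV[F]_n) :
  \rank (diag_mx d) = #|[set i | d 0 i != 0]|.
Proof.
set S := [set i | _].
pose U : 'M[F]_(#|S|, n) := \matrix_(i, j) (enum_val i == j)%:R.
have UUt : U *m U^T = 1%:M.
  apply/matrixP=> i j; rewrite !mxE (bigD1 (enum_val i)) //= !mxE eqxx mul1r.
  rewrite big1 ?addr0 ?(inj_eq enum_val_inj) ?(eq_sym j) // => k.
  by rewrite !mxE eq_sym => /negPf ->; rewrite mul0r.
have rkU : \rank U = #|S| by apply/eqP/row_freeP; exists U^T.
have rowU k : row k U = delta_mx 0 (enum_val k).
  by apply/rowP=> j; rewrite !mxE eqxx eq_sym.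
rewrite -rkU; apply: eqmx_rank; apply/andP; split; apply/row_subP=> i.
  have -> : row i (diag_mx d) = d 0 i *: delta_mx 0 i.
    by apply/rowP=> j; rewrite !mxE eqxx /= mulr_natr (eq_sym j).
  have [->|di] := eqVneq (d 0 i) 0; first by rewrite scale0r sub0mx.
  have iS : i \in S by rewrite inE.
  by rewrite scalemx_sub // -(enum_rankK_in iS iS) -rowU row_sub.
have dk : d 0 (enum_val i) != 0 by have := enum_valP i; rewrite inE.
have -> : row i U = (d 0 (enum_val i))^-1 *: row (enum_val i) (diag_mx d).
  by apply/rowP=> j; rewrite !mxE -[d _ _ *+ _]mulr_natr mulKf.
by rewrite scalemx_sub // row_sub.
Qed.

Lemma conj_mulmx (F : fieldType) n (U D E : 'M[F]_n) : U \in unitmx ->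
  (invmx U *m D *m U) *m (invmx U *m E *m U) = invmx U *m (D *m E) *m U.
Proof. by move=> Uu; rewrite !mulmxA mulmxK. Qed.

Lemma char_poly_conj (F : fieldType) n (U D : 'M[F]_n) : U \in unitmx ->
  char_poly (invmx U *m D *m U) = char_poly D.
Proof.
move=> Uu; have VU : map_mx polyC (invmx U) *m map_mx polyC U = 1%:M.
  by rewrite -map_mxM mulVmx // map_mx1.
have detVU : \det (map_mx polyC (invmx U)) * \det (map_mx polyC U) = 1.
  by rewrite -det_mulmx VU det1.
rewrite /char_poly -[RHS]mul1r -detVU mulrAC -!det_mulmx; congr (\det _).
rewrite /char_poly_mx mulmxBr mulmxBl !map_mxM; congr (_ - _).
by rewrite scalar_mxC -mulmxA VU mulmx1.
Qed.

Section RealSymmetric.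
Variables (R : rcfType) (n : nat) (A : 'M[R]_n).
Hypothesis A_sym : A^T = A.
Local Open Scope complex_scope.
Local Notation C := (R[i]).
Local Notation toC := (map_mx (real_complex R)).

(** The spectral theorem for hermitian matrices is applied over [R[i]]. The eigenvalues are real and
    come back to [R]; the eigenvectors stay complex. *)
Lemma symmetric_diagonalization :
  exists (U : 'M[C]_n) (d : 'rV[R]_n),
    [/\ U \in unitmx, invmx U = map_mx Num.conj U^T
      & toC A = invmx U *m toC (diag_mx d) *m U].
Proof.
have AC_herm : toC A \is hermsymmx.
  apply: realsym_hermsym.
    by apply/is_hermitianmxP; rewrite expr0 scale1r map_mx_id // map_trmx A_sym.
  by apply/mxOverP => i j; rewrite mxE complex_real.
have /orthomx_spectralP AE := hermitian_normalmx AC_herm.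
have /mxOverP dR := hermitian_spectral_diag_real AC_herm.
exists (spectralmx (toC A)), (map_mx (@complex.Re R) (spectral_diag (toC A))).
split; first exact: spectral_unit.
  by rewrite invmx_unitary ?spectral_unitarymx // map_trmx.
have -> : toC (diag_mx (map_mx (@complex.Re R) (spectral_diag (toC A)))) =
          diag_mx (spectral_diag (toC A)); last exact: AE.
apply/matrixP=> i j; rewrite !mxE.
by case: eqP => _; rewrite ?mulr0n ?rmorph0 // !mulr1n RRe_real.
Qed.

(** The weight [w i] is the squared modulus of the [i]-th coordinate of [v] in the unitary
    eigenbasis, so the moments of [A] at [v] are those of a positive measure on the real spectrum.
    No complex vector is needed after this point. *)
Lemma symmetric_spectral_measure :
  exists d : 'rV[R]_n,
    [/\ forall i, eigenvalue A (d 0 i),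
        mup 0 (char_poly A) = (n - \rank A)%N
      & forall v : 'rV_n, exists2 w : 'I_n -> R, forall i, 0 <= w i
        & forall k, (v *m A ^+ k *m v^T) 0 0 = \sum_i w i * d 0 i ^+ k].
Proof.
have [U [d [Uu Uinv AE]]] := symmetric_diagonalization.
have cpA : char_poly A = \prod_(a <- [seq d 0 i | i <- enum 'I_n]) ('X - a%:P).
  apply: (map_poly_inj (real_complex R)).
  rewrite map_char_poly AE char_poly_conj // -map_char_poly; congr map_poly.
  rewrite char_poly_trig ?diag_mx_is_trig // big_map big_enum /=.
  by apply: eq_bigr => i _; rewrite mxE eqxx mulr1n.
exists d; split.
- move=> i; rewrite eigenvalue_root_char cpA root_prod_XsubC.
  by rewrite map_f // mem_enum.
- rewrite -(mxrank_map (real_complex R)) AE mxrankMfree ?row_free_unit //.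
  rewrite eqmxMfull ?row_full_unit ?unitmx_inv // mxrank_map rank_diag_mx.
  rewrite cpA mu_prod_XsubC count_map.
  have -> : count (preim (d 0) (pred1 0)) (enum 'I_n) = #|[set i | d 0 i == 0]|.
    by rewrite -sum1_count big_enum_cond -sum1_card; apply: eq_bigl => i; rewrite !inE.
  have -> : [set i | d 0 i == 0] = ~: [set i | d 0 i != 0].
    by apply/setP=> i; rewrite !inE negbK.
  by rewrite cardsCs setCK card_ord.
move=> v; pose w := toC v *m invmx U.
exists (fun i => complex.Re (w 0 i) ^+ 2 + complex.Im (w 0 i) ^+ 2).
  by move=> i; rewrite addr_ge0 // sqr_ge0.
move=> k; apply: (@complexI R).
have AkE : toC (A ^+ k) = invmx U *m toC (diag_mx (\row_i d 0 i ^+ k)) *m U.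
  elim: k => [|k IH].
    rewrite expr0 map_mx1.
    have -> : \row_i d 0 i ^+ 0 = const_mx 1.
      by apply/rowP=> i; rewrite !mxE.
    by rewrite diag_const_mx map_mx1 mulmx1 mulVmx.
  have -> : diag_mx (\row_i d 0 i ^+ k.+1) = diag_mx (\row_i d 0 i ^+ k) *m diag_mx d.
    by rewrite mulmx_diag; congr diag_mx; apply/rowP=> i; rewrite !mxE exprSr.
  rewrite exprSr -[A ^+ k * A]/(A ^+ k *m A) !map_mxM IH.
  by rewrite [X in _ *m X]AE; apply: conj_mulmx.
(* As [v] is real and [U] unitary, the right-hand factor [U v^T] is the conjugate of [w^T], and the
   products below become squared moduli. *)
have wE : map_mx Num.conj w^T = U *m toC v^T.
  rewrite /w Uinv trmx_mul map_mxM -!map_trmx trmxK; congr (_ *m _).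
    by apply/matrixP=> i j; rewrite !mxE; apply: conjCK.
  by apply/matrixP=> i j; rewrite !mxE; apply/CrealP; rewrite complex_real.
have -> : real_complex R ((v *m A ^+ k *m v^T) 0 0) =
          (toC (v *m A ^+ k *m v^T)) 0 0 by rewrite [RHS]mxE.
rewrite !map_mxM AkE -!mulmxA -wE !mulmxA -/w.
clearbody w; rewrite !mxE rmorph_sum /=.
apply: eq_bigr => i _; rewrite mxE (bigD1 i) //= !mxE big1 ?addr0; last first.
  by move=> j /negPf ji; rewrite !mxE ji mulr0n rmorph0 mulr0.
by rewrite eqxx mulr1n [RHS]rmorphM /= add_Re2_Im2 normCK mulrAC.
Qed.
End RealSymmetric.

(** * Quadratic forms of a bipartite graph *)

Section InnerProduct.
Variables (R : realFieldType) (n : nat).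
Implicit Types u v w : 'rV[R]_n.

Definition ip u v : R := (u *m v^T) 0 0.

Lemma ipE u v : ip u v = \sum_i u 0 i * v 0 i.
Proof. by rewrite /ip mxE; apply: eq_bigr => i _; rewrite mxE. Qed.

Lemma ipC u v : ip u v = ip v u.
Proof. by rewrite !ipE; apply: eq_bigr => i _; rewrite mulrC. Qed.

Lemma ipDl u v w : ip (u + v) w = ip u w + ip v w.
Proof. by rewrite /ip mulmxDl mxE. Qed.

Lemma ipNl u w : ip (- u) w = - ip u w.
Proof. by rewrite /ip mulNmx mxE. Qed.

Lemma ipZl a u w : ip (a *: u) w = a * ip u w.
Proof. by rewrite /ip -scalemxAl mxE. Qed.

Lemma ip0l w : ip 0 w = 0.
Proof. by rewrite /ip mul0mx mxE. Qed.

Lemma ipDr w u v : ip w (u + v) = ip w u + ip w v.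
Proof. by rewrite ipC ipDl !(ipC w). Qed.

Lemma ipNr w u : ip w (- u) = - ip w u.
Proof. by rewrite ipC ipNl (ipC w). Qed.

Lemma ipZr a w u : ip w (a *: u) = a * ip w u.
Proof. by rewrite ipC ipZl (ipC w). Qed.

Lemma ip0r w : ip w 0 = 0.
Proof. by rewrite ipC ip0l. Qed.

Definition ip_linear := (ipDl, ipDr, ipNl, ipNr, ipZl, ipZr).

Lemma ip_suml (I : finType) (P : pred I) (F : I -> 'rV[R]_n) w :
  ip (\sum_(i | P i) F i) w = \sum_(i | P i) ip (F i) w.
Proof.
by rewrite (big_morph (ip^~ w) (fun x y => ipDl x y w) (ip0l w)).
Qed.

Lemma ip_eq0 u : ip u u = 0 -> u = 0.
Proof.
rewrite ipE => /eqP; rewrite psumr_eq0 => [|i _]; last by rewrite -expr2 sqr_ge0.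
move/allP=> u0; apply/rowP=> i; rewrite mxE; apply/eqP.
by have := u0 i (mem_index_enum i); rewrite mulf_eq0 orbb.
Qed.

End InnerProduct.

Section AdjacencyForms.
Variables (R : rcfType) (G : sgraph).
Local Notation A := (adjmx R G).

Definition ev (x : G) : 'rV[R]_#|G| := delta_mx 0 (enum_rank x).

Lemma adjmx_sym : A^T = A.
Proof. by apply/matrixP=> i j; rewrite !mxE adj_sym. Qed.

Lemma ip_adjmx (u v : 'rV[R]_#|G|) : ip (u *m A) v = ip u (v *m A).
Proof. by rewrite /ip trmx_mul adjmx_sym mulmxA. Qed.

Lemma ip_ev f x : ip f (ev x) = f 0 (enum_rank x).
Proof.
rewrite ipE (bigD1 (enum_rank x)) //= !mxE !eqxx mulr1 big1 ?addr0 // => i.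
by move/negPf=> ix; rewrite !mxE ix mulr0.
Qed.

Lemma ip_evv x y : ip (ev x) (ev y) = (x == y)%:R.
Proof. by rewrite ip_ev mxE eqxx (inj_eq enum_rank_inj) eq_sym. Qed.

Lemma ev_adjmx x : ev x *m A = \sum_(y | adj x y) ev y.
Proof.
rewrite -rowE; apply/rowP=> j; rewrite !mxE enum_rankK summxE.
rewrite big_mkcond (bigD1 (enum_val j)) //= big1 => [|y].
  by rewrite addr0 mxE enum_valK !eqxx; case: adj.
move=> /negPf jy; case: adj => //; rewrite mxE eqxx /=.
by rewrite -[j]enum_valK (inj_eq enum_rank_inj) eq_sym jy.
Qed.

Definition codeg (x y : G) : nat := #|[set z | adj x z && adj y z]|.

Lemma codegC x y : codeg x y = codeg y x.
Proof. by apply: eq_card => z; rewrite !inE andbC. Qed.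

Lemma codegxx x : codeg x x = degree x.
Proof. by apply: eq_card => z; rewrite !inE andbb. Qed.

Lemma ip_ev_adj x f : ip (ev x *m A) f = \sum_(y | adj x y) ip f (ev y).
Proof. by rewrite ev_adjmx ip_suml; apply: eq_bigr => y _; rewrite ipC. Qed.

(** These are the entries of [A ^ 2]; with [ip_evv] they turn the form of a test vector into degrees
    and numbers of common neighbours. *)
Lemma ip_ev_adj2 x y : ip (ev x *m A) (ev y *m A) = (codeg x y)%:R.
Proof.
rewrite ip_ev_adj /codeg -sum1_card natr_sum big_mkcond [RHS]big_mkcond /=.
apply: eq_bigr => z _; rewrite inE; case: (adj x z) => //=.
rewrite ip_ev_adj (big_mkcond (adj y)) (bigD1 z) //= big1 ?addr0.
  by rewrite ip_evv eqxx.
by move=> t tz; case: adj => //; rewrite ip_evv eq_sym (negPf tz).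
Qed.


(** * Colour classes and the block structure of the adjacency matrix *)

Section Bipartite.
Variable clr : G -> bool.
Hypothesis clr_adj : forall x y, adj x y -> clr y = ~~ clr x.

(** Taking the coordinate projection as a matrix makes support in a class a row space condition, so
    that the kernel inside a class can be counted by ranks. *)
Definition mask (b : bool) : 'M[R]_#|G| := diag_mx (\row_i (clr (enum_val i) == b)%:R).
Definition colour_class (b : bool) : {set G} := [set x | clr x == b].
Definition supp (b : bool) (f : 'rV[R]_#|G|) := forall x, clr x != b -> ip f (ev x) = 0.

Lemma ip_mask b f x : ip (f *m mask b) (ev x) = (clr x == b)%:R * ip f (ev x).
Proof.
by rewrite !ip_ev mul_mx_diag !mxE enum_rankK mulrC.
Qed.

Lemma ip_ext (f g : 'rV[R]_#|G|) : (forall x, ip f (ev x) = ip g (ev x)) -> f = g.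
Proof.
by move=> fg; apply/rowP=> i; have := fg (enum_val i); rewrite !ip_ev enum_valK.
Qed.

Lemma supp_mask b f : supp b f -> f *m mask b = f.
Proof.
move=> fb; apply: ip_ext => x; rewrite ip_mask.
by case: eqP => [_|/eqP xb]; rewrite ?mul1r // fb // mulr0.
Qed.

Lemma mask_supp b f : supp b (f *m mask b).
Proof. by move=> x /negPf xb; rewrite ip_mask xb mul0r. Qed.

Lemma supp_submx b f : (f <= mask b)%MS <-> supp b f.
Proof.
split=> [/submxP [g ->]|/supp_mask <-]; first exact: mask_supp.
exact: submxMl.
Qed.

Lemma mask_adjmx b : mask b *m A = A *m mask (~~ b).
Proof.
rewrite mul_diag_mx mul_mx_diag; apply/matrixP=> i j; rewrite !mxE.
case a: adj; rewrite ?mulr0 ?mul0r // mulr1 mul1r (clr_adj a).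
by case: (clr _) b => [] [].
Qed.

Lemma mask_mask b : mask b *m mask (~~ b) = 0.
Proof.
rewrite mulmx_diag; apply/matrixP=> i j; rewrite !mxE -natrM mulnb.
by case: (clr _) b => [] [] /=; rewrite mul0rn.
Qed.

Lemma mask_add b : mask b + mask (~~ b) = 1%:M.
Proof.
rewrite -raddfD -diag_const_mx; congr diag_mx; apply/rowP=> i; rewrite !mxE.
by case: (clr _) b => [] [] /=; rewrite ?addr0 ?add0r.
Qed.

Lemma ip_mask_sym b f g : ip (f *m mask b) g = ip f (g *m mask b).
Proof. by rewrite /ip trmx_mul tr_diag_mx mulmxA. Qed.

Lemma rank_mask b : \rank (mask b) = #|colour_class b|.
Proof.
rewrite rank_diag_mx -[RHS](card_imset _ enum_rank_inj); apply: eq_card => i.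
rewrite inE mxE; apply/idP/imsetP => [h|[x]].
  exists (enum_val i); rewrite ?enum_valK // inE.
  by move: h; case: (_ == b) => //; rewrite mulr0n eqxx.
by rewrite inE => /eqP xb ->; rewrite enum_rankK xb eqxx oner_eq0.
Qed.

(** As [A] is symmetric, its two off-diagonal blocks are transposes of each other and have equal
    rank; their row spaces lie in opposite classes, so the two ranks add up to that of [A]. *)
Lemma rank_mask_adjmx b : (\rank (mask b *m A) * 2 = \rank A)%N.
Proof.
have rk_sym : \rank (mask (~~ b) *m A) = \rank (mask b *m A).
  by rewrite -mxrank_tr trmx_mul tr_diag_mx adjmx_sym -mask_adjmx.
have AE : (A :=: mask b *m A + mask (~~ b) *m A)%MS.
  apply/eqmxP/andP; split; last by rewrite addsmx_sub !submxMl.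
  by rewrite -[X in (X <= _)%MS]mul1mx -(mask_add b) mulmxDl addmx_sub_adds.
rewrite AE mxrank_disjoint_sum ?rk_sym ?muln2 ?addnn //.
apply/eqP/rowV0P => v; rewrite sub_capmx => /andP [/submxP [x ->]].
move=> /submxP [y xy]; rewrite -[LHS]mulmx1 -(mask_add b) mulmxDr.
rewrite {2}xy !mask_adjmx negbK !mulmxA -!(mulmxA _ (mask _) (mask _)).
have mm : mask (~~ b) *m mask b = 0 by rewrite -[b in X in _ *m X]negbK mask_mask.
by rewrite mm mask_mask !mulmx0 addr0.
Qed.

(** The sign matrix [S] is an involution that anticommutes with [A], so it sends eigenvectors for
    [a] to eigenvectors for [- a]. *)
Lemma eigenvalue_opp a : eigenvalue A a -> eigenvalue A (- a).
Proof.
move=> /eigenvalueP [v vA v0]; apply/eigenvalueP.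
pose S := mask true - mask false.
have SA : S *m A = - (A *m S).
  by rewrite mulmxBl mulmxBr !mask_adjmx opprB.
have SS : S *m S = 1%:M.
  rewrite -(mask_add true) /S mulmxBl !mulmxBr (mask_mask true) (mask_mask false).
  rewrite subr0 sub0r opprK !mulmx_diag.
  congr (diag_mx _ + diag_mx _); apply/rowP=> i; rewrite !mxE -natrM mulnb andbb //.
exists (v *m S); first by rewrite -mulmxA SA mulmxN mulmxA vA -scalemxAl scaleNr.
by apply: contraNneq v0 => vS; rewrite -[v]mulmx1 -SS mulmxA vS mul0mx.
Qed.

(** * Quadratic inequalities from the spectral gap *)

Section Gap.
Hypothesis nullity2 : nullity R G = 2.
Hypothesis gap : forall a : R, eigenvalue A a -> ~ (0 < a < 1) /\ ~ (1 < a < 2).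

Lemma corank_adjmx : (#|G| - \rank A)%N = 2.
Proof. by have [d [_ <- _]] := symmetric_spectral_measure adjmx_sym. Qed.

Lemma eigenvalue_sqr a : eigenvalue A a -> [\/ a = 0, a ^+ 2 = 1 | 4 <= a ^+ 2].
Proof.
wlog a0 : a / 0 <= a => [H ea|].
  have [/H|/ltW a0] := leP 0 a; first exact.
  have := H (- a); rewrite oppr_ge0 sqrrN => /(_ a0 (eigenvalue_opp ea)).
  case=> [/eqP h|->|]; last by constructor 3.
    by constructor 1; apply/eqP; rewrite -oppr_eq0.
  by constructor 2.
move=> /gap [g1 g2].
have [->|an0] := eqVneq a 0; first by constructor 1.
have [->|an1] := eqVneq a 1; first by constructor 2; rewrite expr1n.
constructor 3; suff : 2 <= a by move=> ?; nra.
rewrite leNgt; apply/negP=> a2; have a_gt0 : 0 < a by rewrite lt0r an0.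
have [a1|a1|/eqP] := ltgtP a 1; last by rewrite (negPf an1).
  by apply: g1; rewrite a_gt0.
by apply: g2; rewrite a1.
Qed.

(** The three forms are the moments of order 0, 2 and 4 of one positive measure on the spectrum, so
    an inequality between them reduces to a polynomial inequality at each eigenvalue. *)
Lemma spectral_forms f : exists (d : 'rV[R]_#|G|) (w : 'I_#|G| -> R),
  [/\ forall i, eigenvalue A (d 0 i), forall i, 0 <= w i,
      ip f f = \sum_i w i, ip (f *m A) (f *m A) = \sum_i w i * d 0 i ^+ 2
    & ip (f *m A *m A) (f *m A *m A) = \sum_i w i * d 0 i ^+ 4].
Proof.
have [d [d_eig _ /(_ f) [w w0 wE]]] := symmetric_spectral_measure adjmx_sym.
exists d, w; split=> //.
- have := wE 0%N; rewrite expr0 mulmx1 => E; rewrite /ip E.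
  by apply: eq_bigr => i _; rewrite expr0 mulr1.
- rewrite -wE !ip_adjmx ipC /ip !exprS expr0 mulr1; congr (_ _ _).
  by rewrite -!mulmxE !mulmxA.
rewrite -wE !ip_adjmx ipC /ip !exprS expr0 mulr1; congr (_ _ _).
by rewrite -!mulmxE !mulmxA.
Qed.

(** The polynomial [(t^2 - 1)(t^2 - 4)] is nonnegative when [t^2] is 0, 1 or at least 4. *)
Lemma quartic_form_ge0 f :
  0 <= ip (f *m A *m A) (f *m A *m A) - 5 * ip (f *m A) (f *m A) + 4 * ip f f.
Proof.
have [d [w [d_eig w0 -> -> ->]]] := spectral_forms f.
rewrite !mulr_sumr -sumrB -big_split /=; apply: sumr_ge0 => i _.
have -> : w i * d 0 i ^+ 4 - 5 * (w i * d 0 i ^+ 2) + 4 * w i =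
  w i * ((d 0 i ^+ 2 - 1) * (d 0 i ^+ 2 - 4)) by ring.
apply: mulr_ge0 => //; case: (eigenvalue_sqr (d_eig i)) => [->|->|d4]; first 2 last.
- by apply: mulr_ge0; lra.
- by rewrite expr0n /=; lra.
by rewrite subrr mul0r.
Qed.

Lemma image_form_ge0 f : ip (f *m A) (f *m A) <= ip (f *m A *m A) (f *m A *m A).
Proof.
have [d [w [d_eig w0 _ -> ->]]] := spectral_forms f.
apply: ler_sum => i _; apply: ler_wpM2l => //.
have -> : d 0 i ^+ 4 = d 0 i ^+ 2 * d 0 i ^+ 2 by ring.
by case: (eigenvalue_sqr (d_eig i)) => [->|->|d4]; rewrite ?expr0n ?mulr1 ?mulr0 //; nra.
Qed.

Definition perp_ker b f := forall g, supp b g -> g *m A = 0 -> ip f g = 0.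

(** A vector orthogonal to the kernel of the symmetric matrix [A] is an image [g A], to which
    [image_form_ge0] applies. The masks preserve the kernel, so for [f] of colour [b] orthogonality
    to the kernel vectors of that colour suffices. *)
Lemma perp_ker_form b f : supp b f -> perp_ker b f -> ip f f <= ip (f *m A) (f *m A).
Proof.
move=> fb f_ker; suff /submxP [g ->] : (f <= A)%MS by exact: image_form_ge0.
rewrite submxE; apply/eqP/rowP=> j; rewrite [RHS]mxE.
(* Columns of the cokernel are kernel vectors by symmetry, and only their part of colour [b] pairs
   with [f]. *)
pose k := (col j (cokermx A))^T.
have kA : k *m A = 0.
  by apply: trmx_inj; rewrite trmx_mul adjmx_sym trmxK colE mulmxA mulmx_coker mul0mx trmx0.
have -> : (f *m cokermx A) 0 j = ip f k.
  by rewrite /ip /k trmxK mxE [RHS]mxE; apply: eq_bigr => i _; rewrite [in RHS]mxE.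
rewrite -(supp_mask fb) ip_mask_sym f_ker //; first exact: mask_supp.
by rewrite -mulmxA mask_adjmx mulmxA kA mul0mx.
Qed.

(** Equality makes [f] a minimiser of [|f A|^2 - |f|^2] among the vectors of colour [b] orthogonal
    to the kernel. The vector [h = f A^2 - f], half the gradient, lies in that space, hence
    vanishes; the conclusion is [f A^2 = f] in weak form. *)
Lemma perp_ker_form_eq b f : supp b f -> perp_ker b f ->
  ip (f *m A) (f *m A) = ip f f ->
  forall g, ip (f *m A) (g *m A) = ip f g.
Proof.
move=> fb f_ker fE.
have [h hE] : exists h, h = f *m A *m A - f by exists (f *m A *m A - f).
have hb : supp b h.
  move=> x xb; rewrite hE ipDl ipNl fb // subr0.
  rewrite -(supp_mask fb) -!mulmxA !(mulmxA _ A) mask_adjmx -(mulmxA A) mask_adjmx negbK.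
  by rewrite !mulmxA mask_supp.
have h_ker : perp_ker b h.
  by move=> g gb gA; rewrite hE ipDl ipNl f_ker // !ip_adjmx gA mul0mx ip0r subr0.
(* The form along [f + t h]: the constant term vanishes by equality, and the linear coefficient is
   [2 |h|^2]. *)
have Q0 t : 0 <= t * (2 * ip h h) + t ^+ 2 * (ip (h *m A) (h *m A) - ip h h).
  have /perp_ker_form H : supp b (f + t *: h).
    by move=> x xb; rewrite ipDl ipZl fb // hb // mulr0 addr0.
  have := H _; rewrite mulmxDl -scalemxAl !ip_linear fE.
  rewrite (ipC h f) (ipC (h *m A) (f *m A)).
  have -> : ip (f *m A) (h *m A) = ip h h + ip f h.
    by rewrite -ip_adjmx -ipDl hE subrK.
  move=> /(_ _)/wrap[].
    by move=> g gb gA; rewrite !ip_linear f_ker // h_ker // mulr0 addr0.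
  nra.
have hh0 : ip h h = 0.
  have h0 : 0 <= ip h h by rewrite ipE sumr_ge0 // => i _; rewrite -expr2 sqr_ge0.
  apply/eqP; move: h0; rewrite le_eqVlt eq_sym => /orP [//|h_gt0].
  (* As [c] is positive and bounds the quadratic coefficient from above, [t = - |h|^2 / c] makes the
     form at most [- |h|^4 / c], which is negative. *)
  pose c := `|ip (h *m A) (h *m A) - ip h h| + 1.
  have c_gt0 : 0 < c by rewrite ltr_wpDl.
  have := Q0 (- (ip h h / c)).
  have : ip (h *m A) (h *m A) - ip h h <= c.
    by rewrite (le_trans (ler_norm _)) // lerDl.
  set q := _ - _; move=> qc H; exfalso.
  have : 0 < ip h h / c by rewrite divr_gt0.
  move: H; set s := ip h h / c; have -> : ip h h = s * c by rewrite /s divfK ?gt_eqF.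
  move=> H s_gt0.
  have : s ^+ 2 * q <= s ^+ 2 * c by rewrite ler_wpM2l ?sqr_ge0.
  have : 0 < s ^+ 2 * c by rewrite mulr_gt0 ?exprn_gt0.
  by move: H; clearbody q c s => H H1 H2; lra.
move=> g; rewrite -ip_adjmx -[X in ip X g](subrK f) -hE.
by rewrite (ip_eq0 hh0) add0r.
Qed.

(** Both blocks have half the rank of [A], so the kernel dimension in a class is its size minus a
    common number. The two dimensions add up to 2, and the three cases are those of the dimension in
    the class [true]. *)
Lemma colour_kernel_dichotomy :
  (exists b, (forall f, supp b f -> f *m A = 0 -> f = 0) /\
             #|colour_class (~~ b)| = (#|colour_class b| + 2)%N) \/
  (#|colour_class true| = #|colour_class false| /\
   forall b, exists k, [/\ k != 0, supp b k, k *m A = 0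
      & forall f, supp b f -> f *m A = 0 -> exists c, f = c *: k]).
Proof.
have rkA := corank_adjmx.
have rk b := mxrank_mul_ker (mask b) A.
have rk2 b := rank_mask_adjmx b.
have cardG : (#|colour_class true| + #|colour_class false| = #|G|)%N.
  rewrite -[RHS](cardsC (colour_class true)); congr (_ + _)%N.
  by apply: eq_card => x; rewrite !inE; case: (clr x).
have kerP b f : supp b f -> f *m A = 0 -> (f <= mask b :&: kermx A)%MS.
  by move=> fb fA; rewrite sub_capmx; apply/andP; split;
    [apply/supp_submx|apply/sub_kermxP].
have ker0 b : \rank (mask b :&: kermx A)%MS = 0%N ->
    forall f, supp b f -> f *m A = 0 -> f = 0.
  move=> r0 f fb fA; have := kerP b f fb fA.
  by move/eqP: r0; rewrite mxrank_eq0 => /eqP ->; rewrite submx0 => /eqP.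
have := (rk true, rk false, rk2 true, rk2 false); rewrite !rank_mask.
case=> [[[e1 e2] e3] e4].
have arith p q m ra r1 r2 k1 k2 : (m - ra = 2 -> p + q = m -> r1 + k1 = p ->
    r2 + k2 = q -> r1 * 2 = ra -> r2 * 2 = ra -> k1 + k2 = 2 /\ p + k2 = q + k1)%N.
  by clear; lia.
have [kk pq] := arith _ _ _ _ _ _ _ _ rkA cardG e1 e2 e3 e4.
case k1: (\rank (mask true :&: kermx A)%MS) kk pq => [|[|[|//]]] kk pq.
- by left; exists true; split; [exact: ker0|rewrite /= -[LHS]addn0 -pq; congr addn].
- right; rewrite add1n in kk; case: kk => kk.
  rewrite kk in pq; split; first by move/addIn: pq.
  move=> b; have rb : \rank (mask b :&: kermx A)%MS = 1%N by case: b.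
  pose W := (mask b :&: kermx A)%MS.
  have W0 : W != 0 by rewrite -mxrank_eq0 rb.
  have kW : (nz_row W <= W)%MS := nz_row_sub W.
  have k0 : nz_row W != 0 by rewrite nz_row_eq0.
  exists (nz_row W); move: (kW); rewrite sub_capmx => /andP [kb /sub_kermxP kA].
  split=> //; first exact/supp_submx.
  move=> f fb fA; apply/sub_rVP; apply: submx_trans (kerP b f fb fA) _.
  by rewrite -(geq_leqif (mxrank_leqif_sup kW)) rb lt0n mxrank_eq0.
- left; exists false; move: kk; rewrite -[RHS]addn0 => /addnI kk; rewrite kk addn0 in pq.
  by split; [exact: ker0|].
Qed.
End Gap.
End Bipartite.
End AdjacencyForms.

(** * Rooted trees *)

Section RootedTree.
Local Open Scope nat_scope.
Variable T : sgraph.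
Hypothesis T_acyclic : acyclic T.
Hypothesis T_connected : connected T.

(** Another connection, shortened to a simple path, closes up with the edge to a cycle, so it has at
    most one step; that step would be the removed edge. *)
Lemma edge_bridge (x y : T) : adj x y ->
  ~~ connect [rel u v | adj u v && ((u, v) \notin [:: (x, y); (y, x)])] x y.
Proof.
move=> xy; apply/negP => /connectP [p].
case/shortenP=> q q_path q_uniq _ yE.
have q_adj : path (@adj T) x q by apply: sub_path q_path => u v /= /andP [].
have : size (x :: q) < 3.
  apply: T_acyclic; apply/andP; split=> //.
  by rewrite /= rcons_path q_adj -yE adj_sym.
case: q yE q_path {q_uniq q_adj} => [|z [|//]] /= yE; last first.
  by rewrite yE !inE eqxx /= andbF.
by move: xy; rewrite yE adj_irr.
Qed.

Variable r : T.

Let reach (x : T) k := [exists p : k.-tuple T, path (@adj T) r p && (last r p == x)].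

Let reach_ex x : exists k, reach x k.
Proof.
have /connectP [p rp ->] := T_connected r x.
by exists (size p); apply/existsP; exists (in_tuple p); rewrite rp eqxx.
Qed.

(** The distance from the root [r]. *)
Let d x := ex_minn (reach_ex x).

Let reachP x k : reach x k -> d x <= k.
Proof. by rewrite /d; case: ex_minnP => m _; apply. Qed.

Let d_path x : exists p, [/\ path (@adj T) r p, last r p = x & size p = d x].
Proof.
rewrite /d; case: ex_minnP => m /existsP [p /andP [rp /eqP px]] _.
by exists p; rewrite size_tuple.
Qed.

Let path_d p : path (@adj T) r p -> d (last r p) <= size p.
Proof.
move=> rp; apply: reachP; apply/existsP; exists (in_tuple p).
by rewrite rp eqxx.
Qed.

Let d_adj x y : adj x y -> d y <= (d x).+1.
Proof.
move=> xy; have [p [rp px <-]] := d_path x.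
have := @path_d (rcons p y); rewrite last_rcons size_rcons; apply.
by rewrite rcons_path rp px.
Qed.

Let d_parent x : x != r -> exists2 y, adj x y & d x = (d y).+1.
Proof.
move=> xr; have [p [rp px sp]] := d_path x.
case/lastP: p rp px sp => [_ /= xE|p y]; first by rewrite xE eqxx in xr.
rewrite rcons_path last_rcons size_rcons => /andP [rp py] yx sp.
exists (last r p); first by rewrite adj_sym -yx.
apply/eqP; rewrite eqn_leq; apply/andP; split; first by apply: d_adj; rewrite -yx.
by rewrite -sp ltnS path_d.
Qed.

Let low_connect x z : z != x -> d z <= d x ->
  connect [rel u v | [&& adj u v, u != x & v != x]] r z.
Proof.
have [m] := ubnP (d z); elim: m z => // m IH z zm zx zdx.
have [->|/d_parent [y zy dz]] := eqVneq z r; first exact: connect0.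
have yx : y != x by apply: contraTneq zdx => <-; rewrite dz ltnn.
apply: (@connect_trans _ _ y); last by apply: connect1; rewrite /= adj_sym zy yx zx.
by apply: IH => //; rewrite dz in zm zdx; [exact: zm | exact: ltnW].
Qed.

(** Two distinct neighbours of [x] no farther from the root would both reach it avoiding [x], which
    gives a detour around the edge from [x] to [y]. *)
Let low_unique x y z : adj x y -> adj x z -> d y <= d x -> d z <= d x -> y = z.
Proof.
move=> xy xz dy dz; apply/eqP; apply: contraT => yz.
have yx : y != x by apply: contraTneq xy => ->; rewrite adj_irr.
have zx : z != x by apply: contraTneq xz => ->; rewrite adj_irr.
have /negP [] := edge_bridge xy.
set e := [rel u v | _ && _].
have e_sym : connect_sym e.
  apply: sym_connect_sym => u v; rewrite /= adj_sym !inE !xpair_eqE.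
  by rewrite orbC (andbC (v == _)) (andbC (v == _)).
have sub u : connect [rel u v | [&& adj u v, u != x & v != x]] r u -> connect e r u.
  apply: connect_sub => {}u v /= /and3P [uv /negPf ux /negPf vx].
  by apply: connect1; rewrite /= uv !inE !xpair_eqE ux vx andbF.
apply: (@connect_trans _ _ z).
  by apply: connect1; rewrite /= xz !inE !xpair_eqE (eq_sym z y) (negPf yz) (negPf zx) !andbF.
apply: (@connect_trans _ _ r); last exact/sub/low_connect.
by rewrite e_sym; exact/sub/low_connect.
Qed.

(** At equal distance, [y] and the parent of [x] would coincide by [low_unique], although the parent
    is strictly closer to the root. *)
Let d_neq x y : adj x y -> d x != d y.
Proof.
move=> xy; apply/eqP=> dxy; have [xr|/d_parent [z xz dz]] := eqVneq x r.
  have [yr|/d_parent [z yz dz]] := eqVneq y r.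
    by move: xy; rewrite xr yr adj_irr.
  have d0 : d x = 0 by apply/eqP; rewrite -leqn0 xr; exact: (@path_d [::]).
  by rewrite -dxy d0 in dz.
have zE : z = y by apply: (low_unique xz xy); [rewrite dz | rewrite dxy].
by move: dz; rewrite zE dxy => /n_Sn.
Qed.

(** The default is taken only at the root, which has no neighbour at smaller distance. *)
Let par x := odflt x [pick y | adj x y && (d y < d x)].

Let par_adj x : x != r -> adj x (par x) && (d (par x) < d x).
Proof.
move=> /d_parent [y xy dx]; rewrite /par; case: pickP => [z|/(_ y)] //=.
by rewrite xy dx leqnn.
Qed.

Lemma rooted_tree : exists (p : T -> T) (h : T -> nat),
  (forall x, x != r -> h x = (h (p x)).+1) /\
  (forall x y, adj x y = (x != r) && (p x == y) || (y != r) && (p y == x)).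
Proof.
exists par, d; split=> [x /par_adj /andP [xp dp]|x y].
  by apply/eqP; rewrite eqn_leq dp d_adj // adj_sym.
have parE u v : adj u v -> d v < d u -> (u != r) && (par u == v).
  move=> uv dvu.
  have ur : u != r.
    apply: contraTneq dvu => ->; rewrite -leqNgt.
    by have : d r <= 0 := @path_d [::] isT; lia.
  have /andP [up dp] := par_adj ur.
  by rewrite ur /=; apply/eqP; apply: (low_unique up uv); exact: ltnW.
apply/idP/orP => [xy|[] /andP [/par_adj /andP [a _] /eqP <-] //]; last by rewrite adj_sym.
have := d_neq xy; rewrite neq_ltn => /orP [h|h]; last by left; apply: parE.
by right; apply: parE => //; rewrite adj_sym.
Qed.
End RootedTree.

(** The colour is the parity of the height. Every vertex but the root owns the edge to its parent,
    which has one end in each class, so each class has degree sum equal to the number of edges. *)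
Lemma tree_colouring (T : sgraph) : is_tree T ->
  exists clr : T -> bool,
    (forall x y, adj x y -> clr y = ~~ clr x) /\
    (forall b, \sum_(x | clr x == b) degree x = #|T|.-1)%N.
Proof.
case=> /card_gt0P [r _] Tc Ta; have [p [h [hp pE]]] := rooted_tree Ta Tc r.
exists (fun x => odd (h x)); split=> [x y|b].
  rewrite pE => /orP [] /andP [/hp hx /eqP E]; last by rewrite hx E.
  by rewrite hx E /= negbK.
have degE x : degree x = ((x != r) + \sum_(y | y != r) (p y == x))%N.
  rewrite /degree -sum1_card big_mkcond /=.
  rewrite (eq_bigr (fun y => (x != r) && (p x == y) + (y != r) && (p y == x)))%N.
    rewrite big_split /=; congr addn.
      rewrite (bigD1 (p x)) //= eqxx andbT big1 ?addn0 // => y.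
      by rewrite eq_sym => /negPf ->; rewrite andbF.
    by rewrite [RHS]big_mkcond /=; apply: eq_bigr => y _; case: (y != r).
  move=> y _; rewrite inE pE.
  case: (x =P r) => //= /eqP xr; case: (y =P r) => /= [|/eqP yr]; first by case: eqP.
  (* Two vertices cannot be parents of each other, because heights increase away from the root; so
     at most one of the two terms is 1. *)
  case: (p x =P y) => //= pxy; case: (p y =P x) => //= pyx.
  by have := hp x xr; have := hp y yr; rewrite pxy pyx; lia.
rewrite (eq_bigr _ (fun x _ => degE x)) big_split /=.
rewrite (exchange_big_dep (fun y => y != r)) //=.
transitivity (\sum_(y | y != r) 1)%N; last first.
  by rewrite sum1_card cardC1.
rewrite [X in (X + _)%N]big_mkcond [X in (X + _)%N](bigD1 r) //= eqxx.
rewrite [X in (X + _ + _)%N](_ : _ = 0%N); last by case: ifP.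
rewrite add0n -big_split /=; apply: eq_bigr => y yr.
rewrite yr [X in (_ + X)%N](_ : _ = (odd (h (p y)) == b) :> nat); last first.
  rewrite big_mkcond (bigD1 (p y)) //= eqxx big1 => [|x]; first by case: (_ == b).
  by rewrite eq_sym => /negPf ->; case: ifP.
by rewrite (hp y yr) /=; case: odd b => [] [].
Qed.

(** * Leaves and degrees under the spectral gap *)

Section Sums.
Local Open Scope nat_scope.
Variables (I : finType) (P : pred I) (F G : I -> nat).
Hypothesis leGF : forall i, P i -> G i <= F i.

Lemma eq_of_sum_leq : \sum_(i | P i) F i <= \sum_(i | P i) G i ->
  forall i, P i -> F i = G i.
Proof.
move=> le_sum i Pi; apply/eqP; rewrite eqn_leq leGF // andbT.
move: le_sum; rewrite (bigD1 i) //= [X in _ <= X](bigD1 i) //= => le_sum.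
have : \sum_(j | P j && (j != i)) G j <= \sum_(j | P j && (j != i)) F j.
  by apply: leq_sum => j /andP [/leGF].
lia.
Qed.

(** With [F] the degree and [G] a lower bound for it, this singles out the one branching vertex of a
    colour class. *)
Lemma sum_excess1 : \sum_(i | P i) F i = (\sum_(i | P i) G i).+1 ->
  exists2 h, P h & F h = (G h).+1 /\ forall i, P i -> i != h -> F i = G i.
Proof.
move=> sum_eq.
have [h Ph ltGF] : exists2 h, P h & G h < F h.
  apply/exists_inP; apply: contraT; rewrite negb_exists_in => /forall_inP leFG.
  suff : \sum_(i | P i) F i <= \sum_(i | P i) G i by rewrite sum_eq ltnn.
  by apply: leq_sum => i Pi; rewrite leqNgt leFG.
exists h => //; move: sum_eq; rewrite (bigD1 h) //= [X in _ = X.+1](bigD1 h) //=.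
have : \sum_(j | P j && (j != h)) G j <= \sum_(j | P j && (j != h)) F j.
  by apply: leq_sum => j /andP [/leGF].
move=> le1 eq1; split; first lia.
move=> i Pi ih; apply/eqP; rewrite eqn_leq leGF // andbT.
have : P i && (i != h) by rewrite Pi.
move: eq1 le1; rewrite (bigD1 i) /= ?Pi // [X in (_ + X).+1](bigD1 i) /= ?Pi //.
have : \sum_(j | P j && (j != h) && (j != i)) G j <=
       \sum_(j | P j && (j != h) && (j != i)) F j.
  by apply: leq_sum => j /andP [/andP [/leGF]].
lia.
Qed.
End Sums.

(** * Short paths and common neighbours in a tree *)

Section TreeLocal.
Variables (T : sgraph).
Hypothesis T_acyclic : acyclic T.
Hypothesis T_connected : connected T.
Variable clr : T -> bool.
Hypothesis clr_adj : forall x y, adj x y -> clr y = ~~ clr x.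
Implicit Types x y z a b c : T.

Lemma connected_ind (P : T -> Prop) x0 : P x0 ->
  (forall x y, P x -> adj x y -> P y) -> forall y, P y.
Proof.
move=> P0 PS y; have /connectP [p] := T_connected x0 y.
elim: p x0 P0 => [|z p IH] x0 P0 /=; first by move=> _ ->.
by move=> /andP [xz zp]; apply: (IH z) => //; apply: PS xz.
Qed.

Lemma adj_neq x y : adj x y -> x != y.
Proof. by apply: contraTneq => ->; rewrite adj_irr. Qed.

Lemma clr_neq x y : clr x != clr y -> x != y.
Proof. by apply: contraNneq => ->. Qed.

(** Otherwise [a c b c'] is a cycle of length four. *)
Lemma no_square a b c c' : adj a c -> adj a c' -> adj b c -> adj b c' ->
  c != c' -> a = b.
Proof.
move=> ac ac' bc bc' cc'; apply/eqP; apply: contraT => ab.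
suff : (size [:: a; c; b; c'] < 3)%N by [].
apply: T_acyclic; apply/andP; split.
  by rewrite /= ac (adj_sym c) bc bc' (adj_sym c') ac'.
rewrite /= !inE !negb_or ab cc' (adj_neq ac) (adj_neq ac') (eq_sym c b).
by rewrite (adj_neq bc) (adj_neq bc').
Qed.

Lemma codeg1 x y z : x != y -> adj x z -> adj y z -> codeg x y = 1%N.
Proof.
move=> xy xz yz; apply/eqP/cards1P; exists z; apply/setP=> t; rewrite !inE.
apply/andP/eqP => [[xt yt]|-> //]; apply/eqP; apply: contraNT xy => tz.
by apply/eqP; apply: (no_square xt xz yt yz).
Qed.

Lemma codeg0 x y : (forall z, adj x z -> adj y z -> False) -> codeg x y = 0%N.
Proof.
move=> h; apply/eqP; rewrite cards_eq0; apply/eqP/setP=> z; rewrite !inE.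
by apply/negP => /andP [xz yz]; apply: (h z).
Qed.

(** The vertices [b c a c' b'] form a path, and a common neighbour [z] of its ends would close it to
    a cycle of length six. *)
Lemma codeg_path a b b' c c' : adj a c -> adj a c' -> c != c' ->
  adj c b -> b != a -> adj c' b' -> b' != a -> b != b' /\ codeg b b' = 0%N.
Proof.
move=> ac ac' cc' cb ba cb' ba'.
have bb' : b != b'.
  apply: contraNneq ba => E; rewrite -E in cb'; rewrite eq_sym; apply/eqP.
  by apply: (no_square ac ac') => //; rewrite adj_sym.
split=> //; apply: codeg0 => z bz bz'.
have zc : z != c.
  apply: contraNneq ba' => E; rewrite E in bz'; rewrite eq_sym; apply/eqP.
  by apply: (no_square ac ac') => //; rewrite adj_sym.
have zc' : z != c'.
  apply: contraNneq ba => E; rewrite E in bz; rewrite eq_sym; apply/eqP.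
  by apply: (no_square ac ac') => //; rewrite adj_sym.
suff : (size [:: b; c; a; c'; b'; z] < 3)%N by [].
apply: T_acyclic; apply/andP; split.
  by rewrite /= (adj_sym b) cb (adj_sym c) ac ac' cb' bz' (adj_sym z) bz.
(* Vertices of opposite classes are told apart by their colours; only the pairs inside one class
   need the earlier inequalities. *)
have [ca cb1 cc1 cb'1 cz] : [/\ clr a = ~~ clr c, clr b = ~~ clr c, clr c' = clr c,
    clr b' = ~~ clr c & clr z = clr c].
  have ca : clr a = ~~ clr c by apply: clr_adj; rewrite adj_sym.
  have cb1 : clr b = ~~ clr c by apply: clr_adj.
  have cc1 : clr c' = clr c by rewrite (clr_adj ac') ca negbK.
  split=> //; first by rewrite (clr_adj cb') cc1.
  by rewrite (clr_adj bz) cb1 negbK.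
rewrite /= !inE !negb_or ba bb' cc' (eq_sym c z) zc (eq_sym a b') ba' (eq_sym c' z) zc' /=.
have X : forall u v, clr u != clr v -> u != v by move=> u v; apply: clr_neq.
rewrite !X // ?ca ?cb1 ?cc1 ?cb'1 ?cz //; by case: (clr c).
Qed.

Lemma degree1P x y : degree x = 1%N -> adj x y -> forall z, adj x z = (z == y).
Proof.
move=> /eqP /cards1P [t E] xy z.
have := E; move/setP=> E'; have := E' y; have := E' z; rewrite !inE xy => -> /esym /eqP ->.
by [].
Qed.

Lemma degree2P x y z : degree x = 2%N -> adj x y -> adj x z -> y != z ->
  forall t, adj x t = (t == y) || (t == z).
Proof.
move=> dx xy xz yz t.
suff E : [set y; z] = [set t | adj x t] by have /setP /(_ t) := E; rewrite !inE => ->.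
apply/eqP; rewrite eqEcard cards2 yz -/(degree x) dx leqnn andbT.
by apply/subsetP=> u; rewrite !inE => /orP [] /eqP ->.
Qed.

Lemma degree3P x y z w : degree x = 3%N -> adj x y -> adj x z -> adj x w ->
  y != z -> y != w -> z != w -> forall t, adj x t = [|| t == y, t == z | t == w].
Proof.
move=> dx xy xz xw yz yw zw t.
suff E : [set y; z; w] = [set t | adj x t].
  by have /setP /(_ t) := E; rewrite !inE orbA => ->.
apply/eqP; rewrite eqEcard -setUA cardsU1 !inE negb_or yz yw cards2 zw /=.
rewrite -/(degree x) dx leqnn andbT.
by apply/subsetP=> u; rewrite !inE => /or3P [] /eqP ->.
Qed.

Lemma degree_gt0 x y : adj x y -> (0 < degree x)%N.
Proof. by move=> xy; apply/card_gt0P; exists y; rewrite inE. Qed.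

Lemma other_neighbour x y : adj x y -> degree x != 1%N ->
  exists2 z, adj x z & z != y.
Proof.
move=> xy dx; apply/exists_inP; apply: contraT.
rewrite negb_exists_in => /forall_inP h; case/negP: dx.
apply/cards1P; exists y; apply/setP=> z; rewrite !inE; apply/idP/eqP => [/h|-> //].
by rewrite negbK => /eqP.
Qed.

Lemma other_neighbour2 x : degree x = 2%N -> exists y z, [/\ adj x y, adj x z & y != z].
Proof.
move/eqP/cards2P=> [y [z [yz E]]]; exists y, z.
by have /setP E' := E; have := E' y; have := E' z; rewrite !inE !eqxx orbT => -> ->.
Qed.

Lemma three_neighbours x y : degree x = 3%N -> adj x y -> exists z w,
  [/\ adj x z, adj x w, y != z, y != w & z != w].
Proof.
move=> dx xy; have := cardsD1 y [set t | adj x t].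
rewrite inE xy -/(degree x) dx => -[].
move=> /esym/eqP/cards2P [z [w [zw /setP E]]]; exists z, w.
have := (E z, E w); rewrite !inE !eqxx orbT /=.
by move=> [/andP [zy xz] /andP [wy xw]]; rewrite !(eq_sym y).
Qed.

Lemma card_colour_class (c : bool) : (#|colour_class clr c| + #|colour_class clr (~~ c)| = #|T|)%N.
Proof.
rewrite -(cardsC (colour_class clr c)); congr addn.
by apply: eq_card => x; rewrite !inE; case: (clr x) c => [] [].
Qed.

Lemma sum_class_const (c : bool) k :
  (\sum_(x | clr x == c) k = #|colour_class clr c| * k)%N.
Proof. by rewrite -sum_nat_const; apply: eq_bigl => x; rewrite inE. Qed.

(** * Test vectors and the equality case at a leaf *)

Section Forms.
Variable R : rcfType.
Local Notation A := (adjmx R T).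
Local Notation ev := (@ev R T).

Lemma supp_ev (b : bool) x : clr x = b -> supp clr b (ev x).
Proof. by move=> xb y; rewrite ip_evv; case: (x =P y) => // <-; rewrite xb eqxx. Qed.

Lemma suppD (b : bool) f g : supp clr b f -> supp clr b g -> supp (R := R) clr b (f + g).
Proof. by move=> fb gb x xb; rewrite ipDl fb // gb // addr0. Qed.

Lemma suppZ (b : bool) k f : supp clr b f -> supp (R := R) clr b (k *: f).
Proof. by move=> fb x xb; rewrite ipZl fb // mulr0. Qed.

Lemma suppN (b : bool) f : supp clr b f -> supp (R := R) clr b (- f).
Proof. by move=> fb x xb; rewrite ipNl fb // oppr0. Qed.

(* The test vector by which a vertex of degree two has a leaf neighbour. *)
Lemma path_test a b b' c c' v : adj a c -> adj a c' -> c != c' ->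
  adj c b -> b != a -> adj c' b' -> b' != a ->
  degree a = 2%N -> (degree b + degree b' <= 5)%N ->
  v = 2 *: ev a - ev b - ev b' -> ip (v *m A) (v *m A) < ip v v.
Proof.
move=> ac ac' cc' cb ba cb' ba' da db ->.
have [bb' cod0] := codeg_path ac ac' cc' cb ba cb' ba'.
have c1 : codeg a b = 1%N by apply: (@codeg1 _ _ c); rewrite // 1?eq_sym // adj_sym.
have c2 : codeg a b' = 1%N by apply: (@codeg1 _ _ c'); rewrite // 1?eq_sym // adj_sym.
rewrite !mulmxDl !mulNmx -!scalemxAl !ip_linear !ip_ev_adj2 !ip_evv !eqxx.
rewrite (codegC b a) (codegC b' a) (codegC b' b) cod0 !codegxx c1 c2 da.
rewrite (eq_sym a b) (eq_sym a b') (eq_sym b' b) (negPf ba) (negPf ba') (negPf bb').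
(* The left side has become [degree b + degree b'] and the right side is 6. *)
have : (degree b)%:R + (degree b')%:R <= 5 :> R by rewrite -natrD ler_nat.
by rewrite /= mulr0n; lra.
Qed.

(** The hypothesis says that [A ^ 2] fixes [ev y]; a neighbour of [w] other than [y] would have one
    common neighbour with [y], hence a nonzero entry there. *)
Lemma isolated_edge y w : degree y = 1%N -> adj y w ->
  (forall g, ip (ev y *m A) (g *m A) = ip (ev y) g) -> forall t, t = y \/ t = w.
Proof.
move=> dy yw H; apply: (@connected_ind _ y); first by left.
move=> u t [->|->]; first by rewrite (degree1P dy yw) => /eqP ->; right.
move=> wt; left; apply/eqP; apply: contraT => ty; have := H (ev t).
rewrite ip_ev_adj2 ip_evv (@codeg1 _ _ w) ?(adj_sym t) 1?eq_sym // (negPf ty).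
by move/eqP; rewrite oner_eq0.
Qed.

Lemma ev_adj1 x y : degree x = 1%N -> adj x y -> ev x *m A = ev y.
Proof.
by move=> dx xy; rewrite ev_adjmx (eq_bigl _ _ (degree1P dx xy)) big_pred1_eq.
Qed.

Lemma ev_adj2 x y z : degree x = 2%N -> adj x y -> adj x z -> y != z ->
  ev x *m A = ev y + ev z.
Proof.
move=> dx xy xz yz; rewrite ev_adjmx (eq_bigl _ _ (degree2P dx xy xz yz)).
rewrite (bigD1 y) ?eqxx //=; congr (_ + _); rewrite (big_pred1 z) // => t /=.
by case: (eqVneq t y) => [->|]; rewrite ?andbF ?andbT // (negPf yz).
Qed.

Lemma ev_adj3 x y z w : degree x = 3%N -> adj x y -> adj x z -> adj x w ->
  y != z -> y != w -> z != w -> ev x *m A = ev y + ev z + ev w.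
Proof.
move=> dx xy xz xw yz yw zw.
rewrite ev_adjmx (eq_bigl _ _ (degree3P dx xy xz xw yz yw zw)).
rewrite (bigD1 y) ?eqxx //= -addrA; congr (_ + _).
rewrite (bigD1 z) ?eqxx ?orbT ?(eq_sym z y) ?yz //=; congr (_ + _).
rewrite (big_pred1 w) // => t /=.
case: (eqVneq t y) => [->|ty]; first by rewrite andbF (negPf yw).
by case: (eqVneq t z) => [->|tz]; rewrite ?andbF ?andbT //= (negPf zw).
Qed.

(** * A colour class that carries no kernel vector *)

Section InjectiveClass.
Variable b : bool.
Hypothesis class_form : forall f, supp clr b f -> ip f f <= ip (f *m A) (f *m A).
Hypothesis class_form_eq : forall f, supp clr b f ->
  ip (f *m A) (f *m A) = ip f f -> forall g, ip (f *m A) (g *m A) = ip f g.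
Hypothesis quartic : forall f : 'rV[R]_#|T|,
  0 <= ip (f *m A *m A) (f *m A *m A) - 5 * ip (f *m A) (f *m A) + 4 * ip f f.
Hypothesis card_class : #|colour_class clr (~~ b)| = (#|colour_class clr b| + 2)%N.
Hypothesis degree_sum : (\sum_(x | clr x == b) degree x = #|T|.-1)%N.

(** The form at [ev x] is the degree of [x]. Degree one is the equality case, which makes the tree a
    single edge, against the difference of the class sizes. *)
Lemma class_degree_gt1 x : clr x = b -> (1 < degree x)%N.
Proof.
move=> xb; have := class_form (supp_ev xb); rewrite ip_ev_adj2 ip_evv eqxx codegxx.
rewrite ler_nat leq_eqVlt => /orP [/eqP /esym dx|//].
have /card_gt0P [w] : (0 < degree x)%N by rewrite dx.
rewrite inE => xw.
have H : forall g, ip (ev x *m A) (g *m A) = ip (ev x) g.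
  by apply: class_form_eq; [exact: supp_ev | rewrite ip_ev_adj2 ip_evv eqxx codegxx dx].
have T2 := isolated_edge dx xw H.
have : (#|colour_class clr (~~ b)| <= 1)%N.
  rewrite -(cards1 w); apply/subset_leq_card/subsetP=> t; rewrite !inE => tb.
  by case: (T2 t) tb => -> //; rewrite xb; case: b.
by rewrite card_class addn2.
Qed.

(** The degrees add up to [|T| - 1], which is twice the size of the class plus one, while each is at
    least two. *)
Lemma class_degrees : exists2 h, clr h = b &
  degree h = 3%N /\ forall a, clr a = b -> a != h -> degree a = 2%N.
Proof.
have := @sum_excess1 _ (fun x => clr x == b) (@degree T) (fun _ => 2%N).
case=> [x /eqP /class_degree_gt1 //||h /eqP hb [dh da]].
  rewrite degree_sum -(card_colour_class b) card_class sum_class_const; lia.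
by exists h => //; split=> // a ab ah; apply: da => //; apply/eqP.
Qed.

Lemma class_structure : exists h x y z, [/\ clr h = b, degree h = 3%N,
   [/\ adj h x, adj h y & adj h z], [/\ x != y, x != z & y != z] &
   [/\ degree z = 1%N, degree x != 1%N, degree y != 1%N &
   forall a, clr a = b -> a != h -> degree a = 2%N /\
     forall c c', adj a c -> adj a c' -> c != c' -> degree c != 1%N -> degree c' = 1%N]].
Proof.
have [h hb [dh da]] := class_degrees.
(* If both neighbours of [a] led on to [u] and [u'], [path_test] would contradict [class_form]; the
   bound 5 holds because at most one of [u], [u'] is [h]. *)
have leaf_nbr a : clr a = b -> a != h -> forall c c', adj a c -> adj a c' -> c != c' ->
    degree c != 1%N -> degree c' = 1%N.
  move=> ab ah c c' ac ac' cc' dc; apply/eqP; apply: contraT => dc'.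
  have [] := @other_neighbour c a; rewrite ?(adj_sym c) // => u cu ua.
  have [] := @other_neighbour c' a; rewrite ?(adj_sym c') // => u' cu' ua'.
  have ub : clr u = b by rewrite (clr_adj cu) (clr_adj ac) ab negbK.
  have ub' : clr u' = b by rewrite (clr_adj cu') (clr_adj ac') ab negbK.
  have [uu' _] := codeg_path ac ac' cc' cu ua cu' ua'.
  have du : (degree u + degree u' <= 5)%N.
    have [uh|uh] := eqVneq u h; last by rewrite (da u) //; case: (eqVneq u' h) => [->|/da ->] //; rewrite dh.
    by rewrite uh dh (da u') // -uh eq_sym.
  have := path_test ac ac' cc' cu ua cu' ua' (da a ab ah) du (erefl _).
  rewrite ltNge class_form //.
  by apply: suppD; [apply: suppD; [apply: suppZ|apply: suppN]|apply: suppN]; apply: supp_ev.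
have deg2 c a : adj h c -> adj c a -> a != h -> degree a = 2%N.
  by move=> hc ca ah; apply: da => //; rewrite (clr_adj ca) (clr_adj hc) hb negbK.
(* With three non-leaves next to [h], the vector [ev h - ev a1 - ev a2 - ev a3] has squared norm 4
   and its image only 9 - 6 = 3. *)
have not3 x y z : adj h x -> adj h y -> adj h z -> x != y -> x != z -> y != z ->
    degree x != 1%N -> degree y != 1%N -> degree z != 1%N -> False.
  move=> hx hy hz xy xz yz dx dy dz.
  have [] := @other_neighbour x h; rewrite ?(adj_sym x) // => a1 xa1 a1h.
  have [] := @other_neighbour y h; rewrite ?(adj_sym y) // => a2 ya2 a2h.
  have [] := @other_neighbour z h; rewrite ?(adj_sym z) // => a3 za3 a3h.
  have [n12 c12] := codeg_path hx hy xy xa1 a1h ya2 a2h.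
  have [n13 c13] := codeg_path hx hz xz xa1 a1h za3 a3h.
  have [n23 c23] := codeg_path hy hz yz ya2 a2h za3 a3h.
  have c1 : codeg h a1 = 1%N by apply: (@codeg1 _ _ x); rewrite // 1?eq_sym // adj_sym.
  have c2 : codeg h a2 = 1%N by apply: (@codeg1 _ _ y); rewrite // 1?eq_sym // adj_sym.
  have c3 : codeg h a3 = 1%N by apply: (@codeg1 _ _ z); rewrite // 1?eq_sym // adj_sym.
  have [b1 b2 b3] : [/\ clr a1 = b, clr a2 = b & clr a3 = b].
    by rewrite (clr_adj xa1) (clr_adj hx) (clr_adj ya2) (clr_adj hy) (clr_adj za3)
      (clr_adj hz) hb negbK.
  have : supp clr b (ev h - ev a1 - ev a2 - ev a3).
    by do 3 (apply: suppD; last by apply: suppN; apply: supp_ev); apply: supp_ev.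
  move/class_form; rewrite !mulmxDl !mulNmx !ip_linear !ip_ev_adj2 !ip_evv !eqxx.
  rewrite (codegC a1 h) (codegC a2 h) (codegC a3 h) (codegC a2 a1) (codegC a3 a1).
  rewrite (codegC a3 a2) !codegxx c1 c2 c3 c12 c13 c23 dh (deg2 x a1) // (deg2 y a2) //.
  rewrite (deg2 z a3) // !(eq_sym h) (eq_sym a2 a1) (eq_sym a3 a1) (eq_sym a3 a2).
  rewrite (negPf a1h) (negPf a2h) (negPf a3h) (negPf n12) (negPf n13) (negPf n23).
  by rewrite /= mulr0n; lra.
(* With two leaves next to [h], the quartic form equals -2: at [ev h] if [x] is a leaf as well, and
   otherwise at [ev h - ev a], where [a] lies beyond [x] and carries a leaf [l]. *)
have not2 x y z : adj h x -> adj h y -> adj h z -> x != y -> x != z -> y != z ->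
    degree y = 1%N -> degree z = 1%N -> False.
  move=> hx hy hz xy xz yz dy dz.
  have yA : ev y *m A = ev h by apply: ev_adj1; rewrite // adj_sym.
  have zA : ev z *m A = ev h by apply: ev_adj1; rewrite // adj_sym.
  have hA : ev h *m A = ev x + ev y + ev z by apply: ev_adj3.
  have [dx|dx] := eqVneq (degree x) 1%N.
    have xA : ev x *m A = ev h by apply: ev_adj1; rewrite // adj_sym.
    have := quartic (ev h); rewrite hA !mulmxDl xA yA zA !ip_linear !ip_evv !eqxx.
    rewrite !(eq_sym z) !(eq_sym y x) (negPf xy) (negPf xz) (negPf yz) /= mulr0n; lra.
  have [] := @other_neighbour x h; rewrite ?(adj_sym x) // => a xa ah.
  have ab : clr a = b by rewrite (clr_adj xa) (clr_adj hx) hb negbK.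
  have ax : adj a x by rewrite adj_sym.
  have [] := @other_neighbour a x; rewrite ?(deg2 x a) // => l al lx.
  have dl : degree l = 1%N by apply: (leaf_nbr a ab ah x l); rewrite // eq_sym.
  have lA : ev l *m A = ev a by apply: ev_adj1; rewrite // adj_sym.
  have aA : ev a *m A = ev x + ev l by apply: ev_adj2; rewrite // ?(deg2 x a) // eq_sym.
  have vA : (ev h - ev a) *m A = ev y + ev z - ev l.
    by rewrite mulmxBl hA aA -(addrA (ev x)) opprD addrACA subrr add0r.
  have ly : l != y.
    apply: contraNneq ah => E; have : adj y a by rewrite -E adj_sym.
    by rewrite (degree1P dy (_ : adj y h)) // adj_sym.
  have lz : l != z.
    apply: contraNneq ah => E; have : adj z a by rewrite -E adj_sym.
    by rewrite (degree1P dz (_ : adj z h)) // adj_sym.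
  have := quartic (ev h - ev a); rewrite vA !mulmxDl !mulNmx yA zA lA !ip_linear !ip_evv !eqxx.
  rewrite !(eq_sym h) (eq_sym y l) (eq_sym z l) (eq_sym z y) (negPf ah) (negPf ly) (negPf lz).
  by rewrite (negPf yz) /= mulr0n; lra.
have /card_gt0P [x] : (0 < degree h)%N by rewrite dh.
rewrite inE => hx; have [y [z [hy hz xy xz yz]]] := three_neighbours dh hx.
have rest a : clr a = b -> a != h -> degree a = 2%N /\
     forall c c', adj a c -> adj a c' -> c != c' -> degree c != 1%N -> degree c' = 1%N.
  by move=> ab ah; split; [exact: da | exact: leaf_nbr].
(* By [not2] and [not3], exactly one of the three neighbours of [h] is a leaf; the remaining cases
   only permute the names. *)
have [dx|dx] := eqVneq (degree x) 1%N; have [dy|dy] := eqVneq (degree y) 1%N;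
  have [dz|dz] := eqVneq (degree z) 1%N.
- by case: (not2 x y z).
- by case: (not2 z x y); rewrite // eq_sym.
- by case: (not2 y x z); rewrite // eq_sym.
- by exists h, y, z, x; split; rewrite // ?(eq_sym _ x); split.
- by case: (not2 x y z).
- by exists h, x, z, y; split; rewrite // ?(eq_sym z y); split.
- by exists h, x, y, z; split.
- by case: (not3 x y z).
Qed.
End InjectiveClass.

(** * Classes of equal size, each with a one-dimensional kernel *)

Section BalancedClasses.
Variable kap : bool -> 'rV[R]_#|T|.
Hypothesis kap_neq0 : forall b : bool, kap b != 0.
Hypothesis kap_supp : forall b : bool, supp clr b (kap b).
Hypothesis kapA : forall b : bool, kap b *m A = 0.
Hypothesis kap_span : forall (b : bool) f, supp clr b f -> f *m A = 0 -> exists k : R, f = k *: kap b.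
Hypothesis kap_form : forall (b : bool) f, supp clr b f -> ip f (kap b) = 0 ->
  ip f f <= ip (f *m A) (f *m A).
Hypothesis kap_form_eq : forall (b : bool) f, supp clr b f -> ip f (kap b) = 0 ->
  ip (f *m A) (f *m A) = ip f f -> forall g, ip (f *m A) (g *m A) = ip f g.
Hypothesis card_classes : forall b : bool, #|colour_class clr (~~ b)| = #|colour_class clr b|.
Hypothesis degree_sum : forall b : bool, (\sum_(x | clr x == b) degree x = #|T|.-1)%N.

(** If the kernel vector vanished at the leaf [y], then [ev y] would be orthogonal to it and attain
    equality in the form. The tree would be a single edge, and the kernel vector would be zero. *)
Lemma kap_leaf y : degree y = 1%N -> ip (kap (clr y)) (ev y) != 0.
Proof.
move=> dy; apply/negP => /eqP ky.
have /card_gt0P [w] : (0 < degree y)%N by rewrite dy.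
rewrite inE => yw.
have T2 := isolated_edge dy yw (kap_form_eq (supp_ev (erefl _)) (etrans (ipC _ _) ky) _).
have /negP [] := kap_neq0 (clr y); apply/eqP/ip_ext => t; rewrite ip0l.
have [->|->] : t = y \/ t = w; [|exact: ky|].
  by apply: T2; rewrite ip_ev_adj2 ip_evv eqxx codegxx dy.
by apply: kap_supp; rewrite (clr_adj yw); case: (clr y).
Qed.

Lemma edge_nonleaf x y t : adj x y -> degree y = 1%N -> t != x -> t != y -> degree x != 1%N.
Proof.
move=> xy dy tx ty; apply/eqP=> dx.
suff [E|E] : t = x \/ t = y; [by rewrite E eqxx in tx|by rewrite E eqxx in ty|].
apply: (@connected_ind (fun t => t = x \/ t = y) x); first by left.
move=> u v [->|->]; first by rewrite (degree1P dx xy) => /eqP ->; right.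
by rewrite (degree1P dy (_ : adj y x)) 1?adj_sym // => /eqP ->; left.
Qed.

(** The combination [f] of [ev y1] and [ev y2] orthogonal to the kernel vector attains equality, so
    [A ^ 2] fixes it. At [t] this weighs the common neighbours of [t] with [y1] and with [y2] by
    nonzero values of the kernel vector, so neither count can vanish alone. *)
Lemma two_leaves_sub y1 y2 w1 w2 t : degree y1 = 1%N -> degree y2 = 1%N ->
  clr y1 = clr y2 -> adj y1 w1 -> adj y2 w2 -> w1 != w2 ->
  adj w1 t -> t != y1 -> adj w2 t.
Proof.
move=> d1 d2 cE a1 a2 w12 w1t ty1.
have y12 : y1 != y2.
  by apply: contraNneq w12 => E; rewrite eq_sym -(degree1P d1 a1) E.
have cod : codeg y1 y2 = 0%N.
  apply: codeg0 => z; rewrite (degree1P d1 a1) (degree1P d2 a2) => /eqP -> /eqP E.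
  by rewrite E eqxx in w12.
have ty2 : t != y2.
  apply: contraNneq w12 => E; rewrite -(degree1P d2 a2) adj_sym -E //.
set f := ip (kap (clr y1)) (ev y2) *: ev y1 - ip (kap (clr y1)) (ev y1) *: ev y2.
have fb : supp clr (clr y1) f.
  by apply: suppD; [|apply: suppN]; apply: suppZ; apply: supp_ev.
have fk : ip f (kap (clr y1)) = 0.
  by rewrite /f !ip_linear !(ipC _ (kap _)); ring.
have fE : ip (f *m A) (f *m A) = ip f f.
  rewrite /f !mulmxDl !mulNmx -!scalemxAl !ip_linear !ip_ev_adj2 !ip_evv !eqxx.
  by rewrite (codegC y2 y1) cod !codegxx d1 d2 (eq_sym y2 y1) (negPf y12) /=; ring.
have := kap_form_eq fb fk fE (ev t).
rewrite /f !mulmxDl !mulNmx -!scalemxAl !ip_linear !ip_ev_adj2 !ip_evv.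
have c1 : codeg y1 t = 1%N by apply: (@codeg1 _ _ w1); rewrite // 1?eq_sym // adj_sym.
rewrite c1 (eq_sym y1 t) (negPf ty1) (eq_sym y2 t) (negPf ty2).
have [c0|] := eqVneq (codeg y2 t) 0%N.
  rewrite c0 /= mulr0n !mulr0 mulr1 !subr0 => /eqP.
  by rewrite cE (negPf (kap_leaf d2)).
rewrite -lt0n => /card_gt0P [z]; rewrite inE (degree1P d2 a2) => /andP [/eqP -> tw].
by rewrite adj_sym.
Qed.

(** By [two_leaves_sub] in both directions, [w1] and [w2] share all their neighbours besides the two
    leaves; there is one since [w1] is not a leaf, and only one since there is no square. *)
Lemma two_leaves y1 y2 w1 w2 : degree y1 = 1%N -> degree y2 = 1%N ->
  clr y1 = clr y2 -> adj y1 w1 -> adj y2 w2 -> w1 != w2 ->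
  exists z, [/\ adj w1 z, adj w2 z, z != y1 & degree w1 = 2%N /\ degree w2 = 2%N].
Proof.
move=> d1 d2 cE a1 a2 w12.
have sub12 := two_leaves_sub d1 d2 cE a1 a2 w12.
have sub21 t : adj w2 t -> t != y2 -> adj w1 t.
  by apply: (two_leaves_sub d2 d1 (esym cE) a2 a1); rewrite eq_sym.
have w1y2 : ~~ adj w1 y2 by rewrite adj_sym (degree1P d2 a2).
have w2y1 : ~~ adj w2 y1 by rewrite adj_sym (degree1P d1 a1) eq_sym.
have [z w1z zy1] : exists2 z, adj w1 z & z != y1.
  apply: other_neighbour; first by rewrite adj_sym.
  apply: (@edge_nonleaf w1 y1 w2); rewrite ?(adj_sym w1) ?(eq_sym w2 w1) //.
  by apply: clr_neq; rewrite (clr_adj a2) -cE; case: (clr y1).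
have w2z := sub12 z w1z zy1.
have zy2 : z != y2 by apply: contraNneq w1y2 => <-.
exists z; split=> //; split.
  have -> : degree w1 = #|[set y1; z]|; last by rewrite cards2 eq_sym zy1.
  apply: eq_card => t; rewrite !inE; apply/idP/orP => [w1t|[] /eqP -> //]; last by rewrite adj_sym.
  have [->|ty1] := eqVneq t y1; [by left|right; apply/eqP].
  have w2t := sub12 t w1t ty1; apply/eqP; apply: contraNT w12 => tz; apply/eqP.
  by apply: (no_square w1t w1z w2t w2z).
have -> : degree w2 = #|[set y2; z]|; last by rewrite cards2 eq_sym zy2.
apply: eq_card => t; rewrite !inE; apply/idP/orP => [w2t|[] /eqP -> //]; last by rewrite adj_sym.
have [->|ty2] := eqVneq t y2; [by left|right; apply/eqP].
have w1t := sub21 t w2t ty2; apply/eqP; apply: contraNT w12 => tz; apply/eqP.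
by apply: (no_square w1t w1z w2t w2z).
Qed.

Lemma card_class_gt0 (b : bool) : T -> (0 < #|colour_class clr b|)%N.
Proof.
move=> x; have := card_colour_class b; rewrite card_classes.
have : (0 < #|T|)%N by apply/card_gt0P; exists x.
lia.
Qed.

Lemma all_degree_gt0 x : (0 < degree x)%N.
Proof.
rewrite lt0n; apply/eqP => dx.
have all_x : forall t, t = x.
  apply: (@connected_ind _ x) => // u t -> xt.
  by have := degree_gt0 xt; rewrite dx.
have := card_class_gt0 (~~ clr x) x => /card_gt0P [t]; rewrite inE (all_x t).
by case: (clr x).
Qed.

Lemma degree_sum2 (b : bool) : (\sum_(x | clr x == b) degree x = (#|colour_class clr b| * 2).-1)%N.
Proof. by rewrite degree_sum -(card_colour_class b) card_classes addnn muln2. Qed.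

Lemma sum_class_pred1 (b : bool) a : clr a = b -> (\sum_(x | clr x == b) (x == a) = 1)%N.
Proof.
move=> ab; rewrite (bigD1 a) /= ?ab // eqxx big1 // => x /andP [_ /negPf ->] //.
Qed.

(** * Two leaves with the same neighbour *)

Section Twins.
Variables (b : bool) (y1 y2 w : T).
Hypotheses (y1b : clr y1 = b) (y12 : y1 != y2).
Hypotheses (d1 : degree y1 = 1%N) (d2 : degree y2 = 1%N).
Hypotheses (a1 : adj y1 w) (a2 : adj y2 w).

Let y2b : clr y2 = b.
Proof. by rewrite (clr_adj (_ : adj w y2)) 1?adj_sym // (clr_adj a1) y1b negbK. Qed.

Let wb : clr w = ~~ b.
Proof. by rewrite (clr_adj a1) y1b. Qed.

Let wy1 : adj w y1. Proof. by rewrite adj_sym. Qed.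
Let wy2 : adj w y2. Proof. by rewrite adj_sym. Qed.

Let twin_kap : exists2 k : R, k != 0 & ev y1 - ev y2 = k *: kap b.
Proof.
have [||k kE] := @kap_span b (ev y1 - ev y2).
- by apply: suppD; [|apply: suppN]; apply: supp_ev.
- by rewrite mulmxBl (ev_adj1 d1 a1) (ev_adj1 d2 a2) subrr.
exists k => //; apply/eqP=> k0; have := congr1 (fun f => ip f (ev y1)) kE.
rewrite k0 scale0r ip0l ipDl ipNl !ip_evv eqxx (eq_sym y2) (negPf y12) subr0.
by move/eqP; rewrite oner_eq0.
Qed.

(** The difference [ev y1 - ev y2] spans the kernel of the class, so orthogonality to the kernel
    means equal values at the twins. *)
Let twin_form f : supp clr b f -> ip f (ev y1) = ip f (ev y2) ->
  ip f f <= ip (f *m A) (f *m A).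
Proof.
have [k k0 kE] := twin_kap; move=> fb f12; apply: kap_form fb _.
by apply: (mulfI k0); rewrite mulr0 -ipZr -kE ipDr ipNr f12 subrr.
Qed.

Let twin_leaf t : clr t = b -> degree t = 1%N -> t = y1 \/ t = y2.
Proof.
move=> tb dt; have := kap_leaf dt; rewrite tb; have [k k0 kE] := twin_kap.
have := congr1 (fun f => ip f (ev t)) kE; rewrite ipZl ipDl ipNl !ip_evv => E kt.
case: (y1 =P t) E => [->|_]; [by left|]; case: (y2 =P t) => [->|_]; [by right|].
by rewrite subr0 => /esym /eqP; rewrite mulf_eq0 (negPf k0) (negPf kt).
Qed.

(** The twins are the only leaves of the class, so [lb] bounds the degrees from below. It sums to
    two less than twice the size of the class, one below the degree sum. *)
Let twin_degrees : exists h, [/\ clr h = b, degree h = 3%N &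
  forall a, clr a = b -> a != h -> a != y1 -> a != y2 -> degree a = 2%N].
Proof.
pose lb x := (2 - ((x == y1) + (x == y2)))%N.
have lb1 : lb y1 = 1%N by rewrite /lb eqxx (negPf y12).
have lb2 : lb y2 = 1%N by rewrite /lb eqxx (eq_sym y2) (negPf y12).
have lb3 x : x != y1 -> x != y2 -> lb x = 2%N by rewrite /lb => /negPf -> /negPf ->.
have [x xb||h /eqP hb [dh da]] := @sum_excess1 _ (fun x => clr x == b) (@degree T) lb.
- have [->|x1] := eqVneq x y1; first by rewrite lb1 d1.
  have [->|x2] := eqVneq x y2; first by rewrite lb2 d2.
  rewrite lb3 // ltn_neqAle all_degree_gt0 andbT eq_sym; apply/eqP => /twin_leaf.
  by move=> /(_ (eqP xb)) [E|E]; move: x1 x2; rewrite E eqxx.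
- have : (\sum_(x | clr x == b) (lb x + ((x == y1) + (x == y2))) = #|colour_class clr b| * 2)%N.
    rewrite -sum_class_const; apply: eq_bigr => x _; rewrite /lb subnK //.
    by do 2 case: (_ == _).
  rewrite !big_split /= !sum_class_pred1 // degree_sum2; lia.
have h1 : h != y1 by apply/eqP => E; move: dh; rewrite E d1 lb1.
have h2 : h != y2 by apply/eqP => E; move: dh; rewrite E d2 lb2.
exists h; split=> //; first by rewrite dh lb3.
by move=> a ab ah ay1 ay2; rewrite da ?lb3 // ab.
Qed.

Section TwinsHub.
Variable h : T.
Hypotheses (hb : clr h = b) (dh : degree h = 3%N).
Hypothesis da : forall a, clr a = b -> a != h -> a != y1 -> a != y2 -> degree a = 2%N.

Let off_w c t : adj c t -> c != w -> t != y1 /\ t != y2.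
Proof.
move=> ct cw; split; apply: contraNneq cw => E; move: ct; rewrite E adj_sym.
  by rewrite (degree1P d1 a1).
by rewrite (degree1P d2 a2).
Qed.

Let deg_le3 t : clr t = b -> t != y1 -> t != y2 -> (degree t <= 3)%N.
Proof. by move=> tb t1 t2; have [->|th] := eqVneq t h; [rewrite dh | rewrite da]. Qed.

(** If [c] led on to [u], the vector [2 a - y1 - y2 - 2 u], equal at the twins, would have squared
    norm 10 while its image has [4 * degree u - 4], at most 8. *)
Let leaf_beyond_w a c : clr a = b -> a != h -> a != y1 -> a != y2 -> adj a w ->
  adj a c -> c != w -> degree c = 1%N.
Proof.
move=> ab ah ay1 ay2 aw ac cw; apply/eqP; apply: contraT => dc.
have [] := @other_neighbour c a; rewrite ?(adj_sym c) // => u cu ua.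
have ub : clr u = b by rewrite (clr_adj cu) (clr_adj ac) ab negbK.
have [u1 u2] := off_w cu cw.
have [||y1u c1] := codeg_path aw ac _ wy1 _ cu ua; rewrite 1?(eq_sym w) 1?(eq_sym y1) //.
have [||y2u c2] := codeg_path aw ac _ wy2 _ cu ua; rewrite 1?(eq_sym w) 1?(eq_sym y2) //.
have ca1 : codeg a y1 = 1%N by apply: (@codeg1 _ _ w).
have ca2 : codeg a y2 = 1%N by apply: (@codeg1 _ _ w).
have c12 : codeg y1 y2 = 1%N by apply: (@codeg1 _ _ w).
have cau : codeg a u = 1%N by apply: (@codeg1 _ _ c); rewrite // 1?eq_sym // adj_sym.
have du : (degree u)%:R <= 3 :> R by rewrite ler_nat deg_le3.
set f := 2 *: ev a - ev y1 - ev y2 - 2 *: ev u.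
have fb : supp clr b f.
  apply: suppD; last by apply: suppN; apply: suppZ; apply: supp_ev.
  by do 2 (apply: suppD; last by apply: suppN; apply: supp_ev); apply: suppZ; apply: supp_ev.
have f12 : ip f (ev y1) = ip f (ev y2).
  rewrite /f !ip_linear !ip_evv !eqxx (negPf ay1) (negPf ay2) (negPf u1) (negPf u2).
  by rewrite (eq_sym y2) (negPf y12) /=; ring.
have := twin_form fb f12.
rewrite /f !mulmxDl !mulNmx -!scalemxAl !ip_linear !ip_ev_adj2 !ip_evv !eqxx.
rewrite (codegC y1 a) (codegC y2 a) (codegC u a) (codegC y2 y1) (codegC u y1) (codegC u y2).
rewrite !codegxx ca1 ca2 cau c12 c1 c2 d1 d2 (da ab) //.
rewrite (eq_sym y1 a) (eq_sym y2 a) (eq_sym a u) (eq_sym y1 u) (eq_sym y2 u) (eq_sym y2 y1).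
rewrite (negPf ay1) (negPf ay2) (negPf u1) (negPf u2) (negPf y12) (negPf ua) /= mulr0n.
lra.
Qed.

Let leaf_nbr a c c' : clr a = b -> a != h -> a != y1 -> a != y2 -> adj a c ->
  adj a c' -> c != c' -> degree c != 1%N -> degree c' = 1%N.
Proof.
move=> ab ah ay1 ay2 ac ac' cc' dc.
have [cw|cw] := eqVneq c w.
  by apply: (leaf_beyond_w (a := a)); rewrite // -cw // eq_sym.
have [cw'|cw'] := eqVneq c' w.
  by case/eqP: dc; apply: (leaf_beyond_w (a := a)); rewrite // -cw'.
apply/eqP; apply: contraT => dc'.
have [] := @other_neighbour c a; rewrite ?(adj_sym c) // => u cu ua.
have [] := @other_neighbour c' a; rewrite ?(adj_sym c') // => u' cu' ua'.
have ub : clr u = b by rewrite (clr_adj cu) (clr_adj ac) ab negbK.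
have ub' : clr u' = b by rewrite (clr_adj cu') (clr_adj ac') ab negbK.
have [uu' _] := codeg_path ac ac' cc' cu ua cu' ua'.
have [u1 u2] := off_w cu cw; have [u1' u2'] := off_w cu' cw'.
have du : (degree u + degree u' <= 5)%N.
  have [uh|uh] := eqVneq u h; last by rewrite (da ub) // (leq_add2l 2 _ 3) deg_le3.
  by rewrite uh dh (da ub') // -uh eq_sym.
have := path_test ac ac' cc' cu ua cu' ua' (da ab ah ay1 ay2) du (erefl _).
rewrite ltNge twin_form //.
  by apply: suppD; [apply: suppD; [apply: suppZ|apply: suppN]|apply: suppN]; apply: supp_ev.
rewrite !ip_linear !ip_evv (negPf ay1) (negPf ay2) (negPf u1) (negPf u2).
by rewrite (negPf u1') (negPf u2').
Qed.

(** Otherwise every neighbour of [w] is a twin or has degree two with a leaf beyond it, so the whole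
    tree lies within distance two of [w]; by its colour [h] would then be adjacent to [w]. *)
Let adj_wh : adj w h.
Proof.
apply: contraT => nwh.
pose P t := [\/ t = w, adj w t | exists2 g, adj w g & adj g t].
suff : P h.
  case=> [E|E|[g wg gh]].
  - by move: wb; rewrite -E hb; case: b.
  - by rewrite E in nwh.
  - by move: hb; rewrite (clr_adj gh) (clr_adj wg) wb; case: b.
apply: (@connected_ind P w); first by constructor 1.
move=> u t [->|wu|[g wg gu]] ut.
- by constructor 2.
- by constructor 3; exists u.
have gw : adj g w by rewrite adj_sym.
case: (eqVneq u w) ut => [-> wt|uw ut]; first by constructor 2.
have gb : clr g = b by rewrite (clr_adj wg) wb negbK.
have gh : g != h by apply: contraNneq nwh => <-.
have g1 : g != y1 by apply: contraNneq uw => E; rewrite -(degree1P d1 a1) -E.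
have g2 : g != y2 by apply: contraNneq uw => E; rewrite -(degree1P d2 a2) -E.
have du := leaf_beyond_w gb gh g1 g2 gw gu uw.
by constructor 2; move: ut; rewrite (degree1P du (_ : adj u g)) 1?adj_sym // => /eqP ->.
Qed.

Let hw : adj h w. Proof. by rewrite adj_sym adj_wh. Qed.

(* Otherwise [two_leaves] would give [h] degree two. *)
Let hub_leaf c t g : adj h c -> degree c = 1%N -> degree t = 1%N ->
  adj t g -> g != h -> clr g = b -> False.
Proof.
move=> hc dc dt tg gh gb.
have ch : adj c h by rewrite adj_sym.
have tc : clr t = clr c.
  by rewrite (clr_adj hc) hb -gb (clr_adj tg) negbK.
by have [z [_ _ _ [_]]] := two_leaves dt dc tc tg ch gh; rewrite dh.
Qed.

(** A non-leaf [c] starts a path [h c a t] ending in a leaf. If [c'] is a leaf, [hub_leaf] excludes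
    this. If not, it starts a similar path through [a'], and [two_leaves] gives [a] and [a'] a
    common neighbour, against [codeg_path]. *)
Let hub_nbr_leaf c c' : adj h c -> adj h c' -> c != c' -> c != w -> c' != w ->
  degree c = 1%N.
Proof.
move=> hc hc' cc' cw cw'; apply/eqP; apply: contraT => dc.
have beyond s : adj h s -> s != w -> degree s != 1%N ->
    exists a t, [/\ adj s a, a != h, clr a = b, adj a t & degree t = 1%N].
  move=> hs sw ds; have [] := @other_neighbour s h; rewrite ?(adj_sym s) // => a sa ah.
  have [ay1 ay2] := off_w sa sw.
  have ab : clr a = b by rewrite (clr_adj sa) (clr_adj hs) hb negbK.
  have [] := @other_neighbour a s; rewrite ?(da ab) // ?(adj_sym a) // => t at_ ts.
  exists a, t; split=> //; apply: (leaf_nbr ab ah ay1 ay2 _ at_ _ ds).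
    by rewrite adj_sym.
  by rewrite eq_sym.
have [a [t [ca ah ab at_ dt]]] := beyond c hc cw dc.
have ta : adj t a by rewrite adj_sym.
have [dc'|dc'] := eqVneq (degree c') 1%N; first by case: (hub_leaf hc' dc' dt ta ah ab).
have [a' [t' [ca' ah' ab' at' dt']]] := beyond c' hc' cw' dc'.
have ta' : adj t' a' by rewrite adj_sym.
have [aa' cod] := codeg_path hc hc' cc' ca ah ca' ah'.
have tt' : clr t = clr t' by rewrite (clr_adj at_) (clr_adj at') ab ab'.
have [z [az az' _ _]] := two_leaves dt dt' tt' ta ta' aa'.
have : z \in [set s | adj a s && adj a' s] by rewrite inE az.
by move/eqP: cod; rewrite cards_eq0 => /eqP ->; rewrite inE.
Qed.

(** A further neighbour of [w] would have degree two and carry a leaf, which [hub_leaf] forbids next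
    to the leaf [c1] of [h]. *)
Lemma twin_hub_structure : exists c1 c2,
  [/\ adj h c1, adj h c2, w != c1, w != c2 & c1 != c2] /\
  [/\ degree c1 = 1%N, degree c2 = 1%N &
   forall t, adj w t = [|| t == y1, t == y2 | t == h]].
Proof.
have [c1 [c2 [hc1 hc2 wc1 wc2 c12]]] := three_neighbours dh hw.
have dc1 : degree c1 = 1%N by apply: (@hub_nbr_leaf c1 c2); rewrite // eq_sym.
have dc2 : degree c2 = 1%N by apply: (@hub_nbr_leaf c2 c1); rewrite // eq_sym.
exists c1, c2; do 2 split=> //; move=> t; apply/idP/or3P => [wt|].
  have [_|ty1] := eqVneq t y1; first by constructor 1.
  have [_|ty2] := eqVneq t y2; first by constructor 2.
  have [_|th] := eqVneq t h; first by constructor 3.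
  have tb : clr t = b by rewrite (clr_adj wt) wb negbK.
  have tw : adj t w by rewrite adj_sym.
  have [] := @other_neighbour t w; rewrite ?(da tb) // => s ts sw.
  have ds := leaf_beyond_w tb th ty1 ty2 tw ts sw.
  by case: (hub_leaf hc1 dc1 ds _ th tb); rewrite adj_sym.
by case=> /eqP ->.
Qed.
End TwinsHub.

Lemma twin_structure : exists h c1 c2,
  [/\ degree h = 3%N, [/\ adj h w, adj h c1 & adj h c2],
   [/\ w != c1, w != c2 & c1 != c2], degree c1 = 1%N /\ degree c2 = 1%N &
   forall t, adj w t = [|| t == y1, t == y2 | t == h]].
Proof.
have [h [hb dh da]] := twin_degrees.
have [c1 [c2 [[hc1 hc2 wc1 wc2 c12] [dc1 dc2 wE]]]] := twin_hub_structure hb dh da.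
exists h, c1, c2; split=> //; split=> //.
by rewrite adj_sym wE eqxx !orbT.
Qed.
End Twins.

(** * A class without twin leaves *)

Section NoTwins.
Variable b : bool.
Hypothesis no_twins : forall y1 y2 w, clr y1 = b -> degree y1 = 1%N ->
  degree y2 = 1%N -> adj y1 w -> adj y2 w -> y1 = y2.
Local Notation k' := (kap (~~ b)).

Lemma kap_leaf_nbr x w : clr x = b -> degree x = 1%N -> adj x w -> ip k' (ev w) = 0.
Proof.
move=> xb dx xw; rewrite -(ev_adj1 dx xw) -ip_adjmx kapA ip0l //.
Qed.

(* The kernel equation at a vertex determines the value at one neighbour from
   the others, so the zero next to the leaf [x0] spreads to the whole class. *)
Lemma kap_propagation x0 : clr x0 = b -> degree x0 = 1%N ->
  ~ (forall x, clr x = b -> (degree x <= 2)%N \/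
       exists c, forall t, adj x t -> t != c -> ip k' (ev t) = 0).
Proof.
move=> x0b d0 H.
(* On class [b] the invariant is that [k'] vanishes at all neighbours, on the other class that it
   vanishes at the vertex itself. *)
pose P t := if clr t == b then forall s, adj t s -> ip k' (ev s) = 0
            else ip k' (ev t) = 0.
have sum0 x : \sum_(t | adj x t) ip k' (ev t) = 0.
  by rewrite -ip_ev_adj ip_adjmx kapA ip0r.
have : forall t, P t.
  apply: (@connected_ind P x0).
    rewrite /P x0b eqxx => s x0s; exact: kap_leaf_nbr x0s.
  move=> x y; rewrite /P; have [xb|xb] := eqVneq (clr x) b => Px xy.
    by rewrite (clr_adj xy) xb; case: b (Px _ xy).
  have yb : clr y = b by rewrite (clr_adj xy); case: (clr x) b xb => [] [].
  have yx : adj y x by rewrite adj_sym.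
  rewrite yb eqxx => s ys.
  have [->//|sx] := eqVneq s x.
  have vanish c : adj y c -> (forall t, adj y t -> t != c -> ip k' (ev t) = 0) ->
      ip k' (ev c) = 0.
    move=> yc Hc; have := sum0 y; rewrite (bigD1 c) //= big1 ?addr0 // => t /andP [yt tc].
    exact: Hc.
  have [dy|[c Hc]] := H y yb.
    apply: vanish => // t yt ts; suff -> : t = x by [].
    apply/eqP; apply: contraT => tx; suff : (2 < degree y)%N by rewrite ltnNge dy.
    have -> : 3%N = #|[set s; x; t]|.
      by rewrite -setUA cardsU1 !inE negb_or sx (eq_sym s t) ts cards2 eq_sym tx.
    by apply/subset_leq_card/subsetP=> u; rewrite !inE => /orP [/orP []|] /eqP ->.
  have [sc|sc] := eqVneq s c; last exact: Hc.
  by apply: vanish => // t yt; rewrite sc; apply: Hc.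
move=> Pall; have /negP [] := kap_neq0 (~~ b); apply/eqP/ip_ext => t; rewrite ip0l.
have := Pall t; rewrite /P; case: eqP => // tb _.
by apply: kap_supp; rewrite tb; case: b.
Qed.

(** Degrees of at least two would add up to twice the size of the class, one more than the degree
    sum. *)
Lemma leaf_in_class (c : bool) : T -> exists2 x, clr x = c & degree x = 1%N.
Proof.
move=> x0.
have [/existsP [x /andP [/eqP xc /eqP dx]]|/existsPn nleaf] :=
  boolP [exists x, (clr x == c) && (degree x == 1%N)]; first by exists x.
have : (#|colour_class clr c| * 2 <= \sum_(x | clr x == c) degree x)%N.
  rewrite -sum_class_const; apply: leq_sum => x xc.
  by have := nleaf x; rewrite xc /= ltn_neqAle all_degree_gt0 eq_sym => ->.
by rewrite degree_sum2; have := card_class_gt0 c x0; lia.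
Qed.

Lemma no_twins_false : T -> False.
Proof.
move=> t0; have [l lb dl] := leaf_in_class b t0.
have [q qb dq] := leaf_in_class (~~ b) t0.
apply: (kap_propagation lb dl) => x xb.
pose L := [set x | (clr x == b) && (degree x == 1%N)].
have lL : l \in L by rewrite inE lb dl !eqxx.
have [/existsP [l2 /andP [l2L l2l]]|/existsPn one] := boolP [exists y in L, y != l];
    last first.
  (* If [l] is the only leaf of the class, the degree sum forces degree two at all its other
     vertices. *)
  left; pose lbd x := (2 - (x == l))%N.
  suff E : degree x = lbd x by rewrite E leq_subr.
  apply: (@eq_of_sum_leq _ (fun x => clr x == b) (@degree T) lbd _ _ x); last exact/eqP.
    move=> y /eqP yb; rewrite /lbd; have [->|yl] := eqVneq y l; first by rewrite dl.
    have := one y; rewrite inE yb eqxx yl andbT /= ltn_neqAle all_degree_gt0 eq_sym.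
    by move=> ->.
  have : (\sum_(x | clr x == b) (lbd x + (x == l)) = #|colour_class clr b| * 2)%N.
    by rewrite -sum_class_const; apply: eq_bigr => y _; rewrite /lbd subnK //; case: eqP.
  by rewrite big_split /= sum_class_pred1 // degree_sum2; lia.
move: l2L; rewrite inE => /andP [/eqP l2b /eqP dl2].
have nbr y : exists w, adj y w.
  by have /card_gt0P [w] := all_degree_gt0 y; rewrite inE; exists w.
have [w lw] := nbr l; have [w2 lw2] := nbr l2.
have neq_nbr y u : clr y = b -> degree y = 1%N -> adj y u -> y != l -> w != u.
  by move=> yb dy yu; apply: contraNneq => E; apply/eqP; apply: (no_twins yb dy dl yu); rewrite -E.
have [z [wz w2z zl [dw dw2]]] :=
  two_leaves dl dl2 (etrans lb (esym l2b)) lw lw2 (neq_nbr _ _ l2b dl2 lw2 l2l).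
have zb : clr z = b by rewrite (clr_adj wz) (clr_adj lw) lb negbK.
(* Every leaf of the class hangs on [z] by a path of length two, since [z] is the only neighbour of
   [w] besides [l]. *)
have leaf_z y u : clr y = b -> degree y = 1%N -> adj y u -> adj u z /\ degree u = 2%N.
  move=> yb dy yu; have [E|yl] := eqVneq y l.
    by move: yu; rewrite E (degree1P dl lw) => /eqP ->.
  have [z' [wz' uz' z'l [_ du]]] :=
    two_leaves dl dy (etrans lb (esym yb)) lw yu (neq_nbr _ _ yb dy yu yl).
  split=> //; suff <- : z' = z by [].
  have wl : adj w l by rewrite adj_sym.
  have lz : l != z by rewrite eq_sym.
  move: wz'; rewrite (degree2P dw wl wz lz) (negPf z'l).
  by move/eqP.
pose W := [set u | adj z u && [exists y, (degree y == 1%N) && adj u y]].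
have WP u : u \in W -> degree u = 2%N /\ exists y, [/\ clr y = b, degree y = 1%N & adj y u].
  rewrite inE => /andP [zu /existsP [y /andP [/eqP dy uy]]].
  have yb : clr y = b by rewrite (clr_adj uy) (clr_adj zu) zb negbK.
  have yu : adj y u by rewrite adj_sym.
  by split; [case: (leaf_z y u yb dy yu) | exists y].
pose nb y := odflt y [pick u | adj y u].
have nbP y : adj y (nb y).
  by rewrite /nb; case: pickP => [//|no]; have [u] := nbr y; rewrite no.
have leLW : (#|L| <= #|W|)%N.
  rewrite -(card_in_imset (f := nb) (D := mem L)); last first.
    move=> y y'; rewrite !inE => /andP [/eqP yb /eqP dy] /andP [_ /eqP dy'] E.
    by apply: (no_twins yb dy dy' (nbP y)); rewrite E.
  apply/subset_leq_card/subsetP=> u /imsetP [y].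
  rewrite inE => /andP [/eqP yb /eqP dy] ->; rewrite inE.
  have [uz _] := leaf_z y _ yb dy (nbP y).
  rewrite adj_sym uz; apply/existsP; exists y.
  by rewrite dy eqxx adj_sym nbP.
have sWz : W \subset [set u | adj z u] by apply/subsetP=> u; rewrite !inE => /andP [].
have [/existsP [c /andP [zc cW]]|/existsPn zW] := boolP [exists c, adj z c && (c \notin W)];
    last first.
  (* If all neighbours of [z] were in [W], the tree would consist of [z], [W] and the leaves of the
     class. The leaf [q] of the other class would then lie in [W], whose vertices have degree
     two. *)
  pose P t := [\/ t = z, t \in W | clr t = b /\ degree t = 1%N].
  have : P q.
    apply: (@connected_ind P z); first by constructor 1.
    move=> u t [->|uW|[ub du]] ut.
    - by constructor 2; apply: contraT => tW; have := zW t; rewrite ut tW.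
    - have [du [y [yb dy yu]]] := WP u uW; have [uz _] := leaf_z y u yb dy yu.
      have yz : y != z.
        apply/eqP=> E; have /negP [] := neq_nbr _ _ l2b dl2 lw2 l2l.
        have /eqP -> : w == u by rewrite -(degree1P dy yu) E adj_sym.
        by rewrite eq_sym -(degree1P dy yu) E adj_sym.
      have uy : adj u y by rewrite adj_sym.
      move: ut; rewrite (degree2P du uy uz yz) => /orP [] /eqP ->.
        by constructor 3.
      by constructor 1.
    - constructor 2; have [tz _] := leaf_z u t ub du ut.
      rewrite inE adj_sym tz; apply/existsP; exists u.
      by rewrite du eqxx adj_sym.
  case=> [E|/WP [dq2 _]|[qb' _]].
  - by move: qb; rewrite E zb; case: b.
  - by rewrite dq2 in dq.
  - by move: qb; rewrite qb'; case: b.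
have dz : (#|W| < degree z)%N.
  apply: proper_card; rewrite properE sWz /=; apply/subsetPn; exists c => //.
  by rewrite inE.
have L2 : (1 < #|L|)%N.
  apply/card_gt1P; exists l, l2; split; rewrite ?inE ?lb ?dl ?l2b ?dl2 ?eqxx //.
  by rewrite eq_sym.
(* This lower bound for the degrees already sums to the degree sum of the class, so it is attained:
   [z] has degree [|L| + 1] and the other non-leaves have degree two. *)
pose lbd x := if x == z then #|L|.+1 else (2 - (degree x == 1%N))%N.
have degE : forall y, clr y == b -> degree y = lbd y.
  apply: eq_of_sum_leq => [y yb|].
    rewrite /lbd; have [->|yz] := eqVneq y z; first by apply: leq_ltn_trans dz.
    by have := all_degree_gt0 y; case: (degree y) => [|[|]].
  have zL : degree z != 1%N by rewrite gtn_eqF // (leq_trans L2) // (leq_trans leLW) // ltnW.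
  have : (\sum_(y | clr y == b) (lbd y + (degree y == 1%N)) =
          \sum_(y | clr y == b) (2 + (y == z) * #|L|.-1))%N.
    apply: eq_bigr => y _; rewrite /lbd; have [->|yz] := eqVneq y z.
      by move: L2; rewrite (negPf zL) addn0 mul1n; case: #|L| => [|[|m]].
    by rewrite mul0n addn0 subnK //; case: eqP.
  rewrite !big_split /= -big_distrl /= sum_class_pred1 // sum_class_const degree_sum2.
  have -> : (\sum_(y | clr y == b) (degree y == 1%N) = #|L|)%N.
    rewrite -sum1_card big_mkcond [RHS]big_mkcond /=; apply: eq_bigr => y _.
    by rewrite inE; case: (clr y == b) => //=; case: eqP.
  move: L2 (card_class_gt0 b t0).
  move: (\sum_(y | clr y == b) lbd y)%N #|L| #|colour_class clr b| => s l0 m.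
  by clear; lia.
have [xz|xz] := eqVneq x z; last first.
  by left; rewrite degE ?xb // /lbd (negPf xz) leq_subr.
right; exists c => t; rewrite xz => zt tc.
(* A second neighbour of [z] outside [W] would push its degree to [|W| + 2], above [|L| + 1]. Inside
   [W], [k'] vanishes because a leaf of the class is adjacent. *)
have : t \in W.
  apply: contraT => tW; suff : (#|W|.+2 <= degree z)%N.
    by rewrite degE ?zb // /lbd eqxx ltnS => /leq_trans /(_ leLW); rewrite ltnn.
  have -> : #|W|.+2 = #|t |: (c |: W)| by rewrite !cardsU1 in_setU1 (negPf tc) (negPf cW) (negPf tW).
  apply/subset_leq_card/subsetP=> u; rewrite !inE => /or3P [/eqP ->|/eqP ->|/andP []] //.
by move/WP => [_ [y [yb dy yt]]]; apply: kap_leaf_nbr yt.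
Qed.
End NoTwins.
End BalancedClasses.
End Forms.
End TreeLocal.

(** * Recognition of Y and S(p, q) *)

Definition embedding (G H : sgraph) (f : G -> H) :=
  injective f /\ forall x y, adj (f x) (f y) = adj x y.

(** The new leaves at [x] are sent to [L x] by enumerating that set. The last two conclusions locate
    the images of the leaves and serve to prove surjectivity; two successive uses build
    [S(p, q)]. *)
Lemma attach_embedding (G T : sgraph) (m : G -> nat) (i : G -> T) (L : G -> {set T}) :
  embedding i -> (forall x, #|L x| = m x) ->
  (forall x t y, t \in L x -> t != i y) ->
  (forall x t y, t \in L x -> adj (i y) t = (y == x)) ->
  (forall x y s t, s \in L x -> t \in L y -> ~~ adj s t) ->
  exists j : attach_leaves m -> T,
    [/\ embedding j, forall x, j (inl x) = i x, forall l, j (inr l) \in L (tag l)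
      & forall x t, t \in L x -> exists l, j (inr l) = t].
Proof.
move=> [i_inj i_adj] cardL L_i L_adj L_L.
pose j (a : attach_leaves m) : T := match a with
  | inl x => i x
  | inr l => enum_val (cast_ord (esym (cardL (tag l))) (tagged l))
  end.
have jL l : j (inr l) \in L (tag l) by apply: enum_valP.
exists j; split=> //; last first.
  move=> x t tL; exists (Tagged (fun x => 'I_(m x)) (cast_ord (cardL x) (enum_rank_in tL t))).
  by rewrite /= cast_ordK enum_rankK_in.
split=> [[x|l] [y|l'] E|[x|l] [y|l']] /=.
- by congr inl; apply: i_inj.
- by have := L_i _ _ x (jL l'); rewrite -E eqxx.
- by have := L_i _ _ y (jL l); rewrite E eqxx.
- congr inr; have tt : tag l = tag l'.
    apply/eqP; rewrite -(L_adj _ _ _ (jL l')) -E; by rewrite (L_adj _ _ _ (jL l)) eqxx.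
  case: l l' tt E {jL} => x k [x' k'] /= xx'; case: _ / xx' in k' *.
  by move=> /enum_val_inj /cast_ord_inj ->.
- exact: i_adj.
- exact: L_adj (jL l').
- by rewrite adj_sym (L_adj _ _ _ (jL l)) eq_sym.
- exact: negbTE (L_L _ _ _ _ (jL l) (jL l')).
Qed.

Lemma embedding_onto (G T : sgraph) (j : G -> T) :
  embedding j -> (forall t, exists a, j a = t) -> isomorphic T G.
Proof.
move=> [j_inj j_adj] /fin_all_exists [g gK]; exists g; split=> [|x y].
  by exists j => // a; apply: j_inj; rewrite gK.
by rewrite -j_adj !gK.
Qed.

Lemma Y_recognition (T : sgraph) (w h y1 y2 c1 c2 : T) :
  connected T ->
  (forall t, adj w t = [|| t == y1, t == y2 | t == h]) ->
  (forall t, adj h t = [|| t == w, t == c1 | t == c2]) ->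
  degree y1 = 1%N -> degree y2 = 1%N -> degree c1 = 1%N -> degree c2 = 1%N ->
  [/\ y1 != y2, y1 != h, y2 != h, w != c1 & w != c2] -> c1 != c2 ->
  isomorphic T Y_tree.
Proof.
move=> Tc wE hE dy1 dy2 dc1 dc2 [y12 y1h y2h wc1 wc2] c12.
have [wy1 wy2 wh] : [/\ adj w y1, adj w y2 & adj w h] by rewrite !wE !eqxx !orbT.
have [hw hc1 hc2] : [/\ adj h w, adj h c1 & adj h c2] by rewrite !hE !eqxx !orbT.
have leafE (x u : T) : degree u = 1%N -> adj x u -> forall t, adj t u = (t == x).
  by move=> du xu t; rewrite adj_sym (degree1P du (_ : adj u x)) // adj_sym.
have y1E := leafE w y1 dy1 wy1; have y2E := leafE w y2 dy2 wy2.
have c1E := leafE h c1 dc1 hc1; have c2E := leafE h c2 dc2 hc2.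
have wh_neq : w != h by apply: adj_neq.
have hwF : (h == w) = false by rewrite eq_sym (negPf wh_neq).
have [y1w y2w c1h c2h] : [/\ y1 != w, y2 != w, c1 != h & c2 != h].
  by rewrite !(eq_sym _ w) !(eq_sym _ h) !adj_neq.
have [|||||j [j_emb jl jr jL]] := @attach_embedding (path_graph 2) T (fun _ => 2%N)
    (fun k : 'I_2 => if val k == 0%N then w else h)
    (fun k : 'I_2 => if val k == 0%N then [set y1; y2] else [set c1; c2]).
- split=> [[[|[|//]] ?] [[|[|//]] ?] /= E|[[|[|//]] ?] [[|[|//]] ?]] /=;
    rewrite ?adj_irr ?wh ?hw //; try exact: val_inj.
    by rewrite E eqxx in wh_neq.
  by rewrite E eqxx in wh_neq.
- by case=> [[|[|//]] ?] /=; rewrite cards2 ?y12 ?c12.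
- by move=> [[|[|//]] ?] t [[|[|//]] ?] /=; rewrite !inE => /orP [] /eqP -> //; rewrite eq_sym.
- by move=> [[|[|//]] ?] t [[|[|//]] ?] /=; rewrite !inE => /orP [] /eqP ->;
    rewrite -val_eqE /= ?y1E ?y2E ?c1E ?c2E ?eqxx ?(negPf wh_neq) ?hwF.
- have nl s t : s \in [:: y1; y2; c1; c2] -> t \in [:: y1; y2; c1; c2] -> ~~ adj s t.
    have sP : s \in [:: y1; y2; c1; c2] -> (s != w) && (s != h).
      by rewrite !inE => /or4P [] /eqP ->; rewrite ?y1w ?y2w ?c1h ?c2h ?y1h ?y2h ?(eq_sym _ w) ?wc1 ?wc2.
    by move=> /sP /andP [sw sh]; rewrite !inE => /or4P [] /eqP ->;
      rewrite ?y1E ?y2E ?c1E ?c2E.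
  by move=> [[|[|//]] ?] [[|[|//]] ?] s t /=; rewrite !inE => /orP [] /eqP -> /orP [] /eqP ->;
    apply: nl; rewrite !inE !eqxx ?orbT.
apply: (embedding_onto j_emb).
have [jw jh] : (exists a, j a = w) /\ (exists a, j a = h).
  by split; [exists (inl (inord 0 : 'I_2))|exists (inl (inord 1 : 'I_2))]; rewrite jl /= inordK.
have jLe (k : 'I_2) t : t \in (if val k == 0%N then [set y1; y2] else [set c1; c2]) ->
    exists a, j a = t by move=> /jL [l <-]; exists (inr l).
apply: (connected_ind Tc (x0 := w)) => // u t [a <-].
case: a => [[[|[|//]] ?]|l]; rewrite ?jl /=.
- rewrite wE => /or3P [] /eqP -> //; apply: (jLe (inord 0 : 'I_2));
    by rewrite /= inordK // !inE eqxx ?orbT.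
- rewrite hE => /or3P [] /eqP -> //; apply: (jLe (inord 1 : 'I_2));
    by rewrite /= inordK // !inE eqxx ?orbT.
have := jr l; case: (tag l) => [[|[|//]] ?] /=; rewrite !inE => /orP [] /eqP ->;
  rewrite adj_sym ?y1E ?y2E ?c1E ?c2E // => /eqP -> //.
Qed.

(** * Reconstruction of S(p, q) from its central vertex *)

Section SRecognition.
Variables (T : sgraph) (clr : T -> bool) (b : bool) (h x y z : T).
Hypotheses (T_acyclic : acyclic T) (T_connected : connected T).
Hypothesis clr_adj : forall u v, adj u v -> clr v = ~~ clr u.
Hypotheses (hb : clr h = b) (dh : degree h = 3%N).
Hypotheses (hx : adj h x) (hy : adj h y) (hz : adj h z).
Hypotheses (xy : x != y) (xz : x != z) (yz : y != z).
Hypotheses (dz : degree z = 1%N) (dx : degree x != 1%N) (dy : degree y != 1%N).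
Hypothesis deg2 : forall a, clr a = b -> a != h -> degree a = 2%N.
Hypothesis leaf_nbr : forall a c c', clr a = b -> a != h ->
  adj a c -> adj a c' -> c != c' -> degree c != 1%N -> degree c' = 1%N.

Let hE t : adj h t = [|| t == x, t == y | t == z].
Proof. exact: degree3P. Qed.

Let xb : clr x = ~~ b. Proof. by rewrite (clr_adj hx) hb. Qed.
Let yb : clr y = ~~ b. Proof. by rewrite (clr_adj hy) hb. Qed.

Let class_nonleaf t : clr t = b -> degree t != 1%N.
Proof. by move=> tb; have [->|th] := eqVneq t h; rewrite ?dh ?deg2. Qed.

Let same_clr u v : clr u = clr v -> adj u v = false.
Proof. by move=> uv; apply/negP => /clr_adj; rewrite uv; case: (clr v). Qed.

Let xy_h t : adj x t -> adj y t -> t = h.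
Proof. by move=> xt yt; apply: (no_square T_acyclic _ _ hx hy xy); rewrite adj_sym. Qed.

(** A vertex [a] at distance two from [h] has a non-leaf neighbour towards [h], so its other
    neighbour is a leaf and the tree ends there. *)
Let radius3 t : [\/ t = h, adj h t, exists2 c, adj h c & adj c t
  | exists c a, [/\ adj h c, adj c a & adj a t]].
Proof.
apply: (connected_ind T_connected (P := fun t => [\/ t = h, adj h t,
  exists2 c, adj h c & adj c t | exists c a, [/\ adj h c, adj c a & adj a t]]) (x0 := h)).
  by constructor 1.
move=> u v [->|hu|[c hc cu]|[c [a [hc ca au]]]] uv.
- by constructor 2.
- by constructor 3; exists u.
- by constructor 4; exists c, u.
constructor 3; have [E|ah] := eqVneq a h; first by exists u; rewrite // -E.
have [uc|uc] := eqVneq u c; first by exists c; rewrite // -uc.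
have ab : clr a = b by rewrite (clr_adj ca) (clr_adj hc) hb negbK.
have dc : degree c != 1%N.
  apply/eqP => dc; move: ca; rewrite (degree1P dc (_ : adj c h)) 1?adj_sym //.
  by rewrite (negPf ah).
have du : degree u = 1%N.
  by apply: (leaf_nbr ab ah _ au _ dc); rewrite 1?adj_sym // eq_sym.
have ua : adj u a by rewrite adj_sym.
by exists c => //; move: uv; rewrite (degree1P du ua) => /eqP ->.
Qed.

Let nonleaf t : degree t != 1%N -> [\/ t = h, t = x, t = y | adj x t || adj y t].
Proof.
move=> dt; have ht_case : adj h t -> [\/ t = h, t = x, t = y | adj x t || adj y t].
  rewrite hE => /or3P [] /eqP E; [by constructor 2|by constructor 3|].
  by rewrite E dz in dt.
have zh : adj z h by rewrite adj_sym.
case: (radius3 t) => [->|//|[c hc ct]|[c [a [hc ca at_]]]].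
- by constructor 1.
- move: hc ct; rewrite hE => /or3P [] /eqP -> ct; try by constructor 4; rewrite ct ?orbT.
  by move: ct; rewrite (degree1P dz zh) => /eqP ->; constructor 1.
apply: ht_case; have [<- //|ah] := eqVneq a h.
have [-> //|tc] := eqVneq t c.
have ab : clr a = b by rewrite (clr_adj ca) (clr_adj hc) hb negbK.
have ch : adj c h by rewrite adj_sym.
have dc : degree c != 1%N.
  by apply/eqP => dc; move: ca; rewrite (degree1P dc ch) (negPf ah).
have ac : adj a c by rewrite adj_sym.
have ct : c != t by rewrite eq_sym.
by rewrite (leaf_nbr ab ah ac at_ ct dc) in dt.
Qed.

(** The two neighbours of [t] are not both leaves, since otherwise the tree would be a path on three
    vertices, without room for [h]. *)
Let one_leaf t : clr t = b -> t != h -> exists c l,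
  [/\ degree c != 1%N, degree l = 1%N & forall s, adj t s = (s == c) || (s == l)].
Proof.
move=> tb th; have [c [c' [tc tc' cc']]] := other_neighbour2 (deg2 tb th).
have tE := degree2P (deg2 tb th) tc tc' cc'.
have [dc|dc] := eqVneq (degree c) 1%N; last first.
  by exists c, c'; split=> //; apply: (leaf_nbr tb th tc tc').
have [dc'|dc'] := eqVneq (degree c') 1%N; last first.
  by exists c', c; split=> // s; rewrite tE orbC.
have ct : adj c t by rewrite adj_sym.
have ct' : adj c' t by rewrite adj_sym.
have : [\/ h = t, h = c | h = c'].
  apply: (connected_ind T_connected (P := fun h => [\/ h = t, h = c | h = c']) (x0 := t)).
    by constructor 1.
  move=> u v [] -> ; rewrite ?tE ?(degree1P dc ct) ?(degree1P dc' ct').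
  - by move=> /orP [] /eqP ->; [constructor 2|constructor 3].
  - by move=> /eqP ->; constructor 1.
  - by move=> /eqP ->; constructor 1.
case=> E; first by rewrite E eqxx in th.
  by move: dh; rewrite E dc.
by move: dh; rewrite E dc'.
Qed.

(** This matches the multiplicities in [S_tree]: within the tree of non-leaves, a pendant vertex
    hangs at each vertex of degree one and at [h]. Vertices of the class opposite to [h] have no
    leaf neighbour. *)
Let leaf_count t : degree t != 1%N ->
  #|[set s | adj t s && (degree s == 1%N)]| =
  ((#|[set s | adj t s && (degree s != 1%N)]| == 1%N) + (t == h))%N.
Proof.
move=> dt; have [tb|tb] := eqVneq (clr t) b; last first.
  have nbr_b s : adj t s -> clr s = b.
    by move/clr_adj=> ->; case: (clr t) b tb => [] [].
  have -> : [set s | adj t s && (degree s != 1%N)] = [set s | adj t s].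
    apply/setP=> s; rewrite !inE; case ts: (adj t s) => //=.
    by rewrite class_nonleaf // nbr_b.
  rewrite -/(degree t) (negPf dt) (_ : t == h = false); last first.
    by apply: contraNF tb => /eqP ->; rewrite hb.
  apply/eqP; rewrite cards_eq0; apply/eqP/setP=> s; rewrite !inE.
  by apply/negP => /andP [/nbr_b /class_nonleaf /negPf ->].
have [->|th] := eqVneq t h.
  have -> : [set s | adj h s && (degree s == 1%N)] = [set z].
    apply/setP=> s; rewrite !inE hE; have [->|sz] := eqVneq s z; first by rewrite dz eqxx !orbT.
    by rewrite orbF; apply/negP=> /andP [/orP [] /eqP ->]; rewrite ?(negPf dx) ?(negPf dy).
  have -> : [set s | adj h s && (degree s != 1%N)] = [set x; y].
    apply/setP=> s; rewrite !inE hE; have [->|sz] := eqVneq s z.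
      by rewrite dz andbF !(eq_sym z) (negPf xz) (negPf yz).
    by rewrite orbF; apply/andP/idP => [[]|/orP [] /eqP ->] //; rewrite eqxx ?orbT.
  by rewrite cards1 cards2 xy.
have [c [l [dc dl tE]]] := one_leaf tb th.
have -> : [set s | adj t s && (degree s == 1%N)] = [set l].
  apply/setP=> s; rewrite !inE tE; have [->|sl] := eqVneq s l; first by rewrite dl orbT.
  by rewrite orbF; apply/negP=> /andP [/eqP ->]; rewrite (negPf dc).
have -> : [set s | adj t s && (degree s != 1%N)] = [set c].
  apply/setP=> s; rewrite !inE tE; have [->|sc] := eqVneq s c; first by rewrite dc.
  by apply/negP=> /andP [/eqP ->]; rewrite dl.
by rewrite !cards1.
Qed.

Lemma S_recognition : exists p q, isomorphic T (S_tree p q).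
Proof.
have [xh yh] : adj x h /\ adj y h by rewrite !(adj_sym _ h).
(* [a0] and [b0], chosen freely, play [v_1] and [v_5]; the remaining neighbours of [x] and [y] other
   than [h] form [Lx] and [Ly], of sizes [p] and [q]. *)
have [a0 xa0 a0h] := other_neighbour xh dx.
have [b0 yb0 b0h] := other_neighbour yh dy.
have a0b : clr a0 = b by rewrite (clr_adj xa0) xb negbK.
have b0b : clr b0 = b by rewrite (clr_adj yb0) yb negbK.
have neq_clr u v : clr u = b -> clr v = ~~ b -> (u == v = false) * (v == u = false).
  move=> ub vb; suff uv : u == v = false by split; rewrite // eq_sym.
  by apply/eqP => E; move: ub; rewrite E vb; case: b.
have ya0 : adj y a0 = false by apply: contraNF a0h => /(xy_h xa0) ->.
have xb0 : adj x b0 = false by apply: contraNF b0h => /xy_h -> //.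
have a0b0 : a0 != b0 by apply: contraTneq yb0 => <-; rewrite ya0.
pose s0 := [:: a0; x; h; y; b0].
pose i0 (k : path_graph 5) : T := nth h s0 (k : 'I_5).
pose Lx := [set t | adj x t & (t != h) && (t != a0)].
pose Ly := [set t | adj y t & (t != h) && (t != b0)].
pose L1 (k : path_graph 5) : {set T} := match val (k : 'I_5) with 1 => Lx | 3 => Ly | _ => set0 end%N.
have LxP t : t \in Lx -> [/\ adj x t, adj y t = false, clr t = b, t != h & (t != a0) && (t != b0)].
  rewrite inE => /and3P [xt th ta0].
  have yt : adj y t = false by apply: contraNF th => /(xy_h xt) ->.
  split=> //; first by rewrite (clr_adj xt) xb negbK.
  by rewrite ta0; apply: contraFneq yt => ->.
have LyP t : t \in Ly -> [/\ adj y t, adj x t = false, clr t = b, t != h & (t != a0) && (t != b0)].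
  rewrite inE => /and3P [yt th tb0].
  have xt : adj x t = false by apply: contraNF th => /xy_h -> //.
  split=> //; first by rewrite (clr_adj yt) yb negbK.
  by rewrite tb0 andbT; apply: contraFneq xt => ->.
have s0_uniq : uniq s0.
  rewrite /= !inE !negb_or a0h a0b0 xy (eq_sym h b0) b0h.
  by rewrite !(neq_clr a0, neq_clr h, neq_clr b0).
have adjF u v : clr u = clr v -> adj u v = false := @same_clr u v.
have adj0 : (adj a0 x = true) * (adj x a0 = true) * (adj h x = true) * (adj x h = true) *
    (adj h y = true) * (adj y h = true) * (adj y b0 = true) * (adj b0 y = true) *
    (adj y a0 = false) * (adj a0 y = false) * (adj x b0 = false) * (adj b0 x = false).
  by rewrite !(adj_sym a0) !(adj_sym b0) xa0 hx xh hy yh yb0 ya0 xb0.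
have i0_emb : embedding i0.
  split=> [k k' /eqP|].
    by rewrite /i0 nth_uniq // => /eqP /val_inj.
  by move=> [[|[|[|[|[|//]]]]] ?] [[|[|[|[|[|//]]]]] ?]; rewrite /i0 /= ?adj0 //;
    apply: adjF; rewrite ?a0b ?b0b ?hb ?xb ?yb.
(* The first attachment embeds [C(p, q)], whose image is exactly the set of non-leaves. *)
have [|||||j1 [j1_emb jl jr jL]] :=
    @attach_embedding (path_graph 5) T (C_mult #|Lx| #|Ly|) i0 L1.
- exact: i0_emb.
- by move=> [[|[|[|[|[|//]]]]] ?]; rewrite /L1 /C_mult /= ?cards0.
- move=> k t [[|[|[|[|[|//]]]]] ?]; rewrite /i0 /L1 /=;
    case: k => [[|[|[|[|[|//]]]]] ?] /=; rewrite ?in_set0 //;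
    try (by move=> /LxP [_ _ tb th /andP [ta0 tb0]]; rewrite // (neq_clr t));
    by move=> /LyP [_ _ tb th /andP [ta0 tb0]]; rewrite // (neq_clr t).
- move=> k t [[|[|[|[|[|//]]]]] ?]; rewrite /i0 /L1 /= -val_eqE /=;
    case: k => [[|[|[|[|[|//]]]]] ?] /=; rewrite ?in_set0 //;
    try (by move=> /LxP [xt yt tb _ _]; rewrite ?xt ?yt // adjF // ?a0b ?b0b ?hb);
    by move=> /LyP [yt xt tb _ _]; rewrite ?xt ?yt // adjF // ?a0b ?b0b ?hb.
- move=> k k' s t; suff LP (k0 : path_graph 5) u : u \in L1 k0 -> clr u = b.
    by move=> /LP sb /LP tb; rewrite adjF // sb.
  by case: k0 => [[|[|[|[|[|//]]]]] ?]; rewrite /L1 /= ?in_set0 //; [case/LxP|case/LyP].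
have [j1_inj j1_adj] := j1_emb.
have j1h : j1 (C_v3 #|Lx| #|Ly|) = h by rewrite jl /i0 /= inordK.
have j1_nonleaf v : degree (j1 v) != 1%N.
  case: v => [[[|[|[|[|[|//]]]]] ?]|l]; rewrite ?jl /i0 //=; try exact: class_nonleaf.
  apply: class_nonleaf; have := jr l; rewrite /L1.
  by case: (val (tag l)) => [|[|[|[|?]]]]; rewrite ?in_set0 //; [case/LxP|case/LyP].
have j1_onto t : degree t != 1%N -> exists v, j1 v = t.
  have pt k : (k < 5)%N -> exists v, j1 v = nth h s0 k.
    by move=> k5; exists (inl (inord k : 'I_5)); rewrite jl /i0 /= inordK.
  move=> /nonleaf [->|->|->|/orP [xt|yt]].
  - exact: (pt 2%N).
  - exact: (pt 1%N).
  - exact: (pt 3%N).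
  - have [->|th] := eqVneq t h; first exact: (pt 2%N).
    have [->|ta0] := eqVneq t a0; first exact: (pt 0%N).
    have [|l <-] := jL (inord 1 : 'I_5) t; last by exists (inr l).
    by rewrite /L1 /= inordK // inE xt th.
  - have [->|th] := eqVneq t h; first exact: (pt 2%N).
    have [->|tb0] := eqVneq t b0; first exact: (pt 4%N).
    have [|l <-] := jL (inord 3 : 'I_5) t; last by exists (inr l).
    by rewrite /L1 /= inordK // inE yt th.
pose L2 v := [set t | adj (j1 v) t && (degree t == 1%N)].
have L2P v t : t \in L2 v -> degree t = 1%N /\ forall s, adj s t = (s == j1 v).
  rewrite inE => /andP [vt /eqP dt]; split=> // s.
  by rewrite adj_sym (degree1P dt (_ : adj t (j1 v))) // adj_sym.
exists #|Lx|, #|Ly|.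
(* The second attachment adds the leaves of the tree, counted at each non-leaf by [leaf_count]. *)
have [|||||j2 [j2_emb j2l j2r j2L]] := @attach_embedding (C_tree #|Lx| #|Ly|) T
    (fun v => ((degree v == 1%N) + (v == C_v3 #|Lx| #|Ly|))%N) j1 L2.
- exact: j1_emb.
- move=> v; rewrite leaf_count // -[in RHS](inj_eq j1_inj) j1h; congr ((_ == _) + _)%N.
  rewrite /degree -(card_imset _ j1_inj); apply: eq_card => t.
  rewrite !inE; apply/andP/imsetP => [[vt /j1_onto [u uE]]|[u]].
    by exists u; rewrite // inE -j1_adj uE.
  by rewrite inE => vu ->; rewrite j1_adj; split=> //; exact: j1_nonleaf.
- by move=> v t u /L2P [dt _]; apply/eqP=> E; have := j1_nonleaf u; rewrite -E dt.
- by move=> v t u /L2P [_ ->]; rewrite (inj_eq j1_inj).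
- move=> v u s t /L2P [ds _] /L2P [_ ->].
  by apply/eqP=> E; have := j1_nonleaf u; rewrite -E ds.
apply: (embedding_onto j2_emb) => t.
have [dt|/j1_onto [v <-]] := eqVneq (degree t) 1%N; last by exists (inl v); rewrite j2l.
have /card_gt0P [s] : (0 < degree t)%N by rewrite dt.
rewrite inE => ts; have [|v vE] := @j1_onto s.
  apply: class_nonleaf; rewrite (clr_adj ts); case tb: (clr t == b).
    by move: (class_nonleaf (eqP tb)); rewrite dt.
  by case: (clr t) b tb => [] [].
have [|l <-] := j2L v t; last by exists (inr l).
by rewrite inE vE adj_sym ts dt.
Qed.
End SRecognition.

(** * The classification *)

Theorem theorem4p4 (R : rcfType) (T : sgraph)
    (T_tree : is_tree T)
    (T_nullity : nullity R T = 2%N)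
    (T_gap : forall a : R, eigenvalue (adjmx R T) a ->
       ~ (0 < a < 1) /\ ~ (1 < a < 2)) :
  isomorphic T Y_tree \/ exists p q : nat, isomorphic T (S_tree p q).
Proof.
have [/card_gt0P [t0 _] Tc Ta] := T_tree.
have [clr [clr_adj degree_sum]] := tree_colouring T_tree.
have form b f fb fk := perp_ker_form clr_adj T_gap (b := b) (f := f) fb fk.
have form_eq b f fb fk := perp_ker_form_eq clr_adj T_gap (b := b) (f := f) fb fk.
have [[b [inj_b card_b]]|[card_eq kernel]] :=
    colour_kernel_dichotomy clr_adj T_nullity.
  right; have perp (f : 'rV[R]_#|T|) : perp_ker clr b f by move=> g gb gA; rewrite (inj_b g gb gA) ip0r.
  have [h [x [y [z [hb dh [hx hy hz] [xy xz yz] [dz dx dy rest]]]]]] :=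
    class_structure Ta Tc clr_adj (fun f fb => form b f fb (perp f))
      (fun f fb => form_eq b f fb (perp f)) (quartic_form_ge0 clr_adj T_gap) card_b
      (degree_sum b).
  apply: (S_recognition Ta Tc clr_adj hb dh hx hy hz xy xz yz dz dx dy) => [a|a c c'] ab ah.
    by have [] := rest a ab ah.
  by have [_] := rest a ab ah; apply.
left.
have [k [k0 kb kA kspan]] : exists k : bool -> 'rV[R]_#|T|, [/\ forall b, k b != 0,
    forall b, supp clr b (k b), forall b, k b *m adjmx R T = 0
    & forall b f, supp clr b f -> f *m adjmx R T = 0 -> exists c : R, f = c *: k b].
  have [kt [t1 t2 t3 t4]] := kernel true; have [kf [f1 f2 f3 f4]] := kernel false.
  by exists (fun b => if b then kt else kf); split; case.
have perp b f : ip f (k b) = 0 -> perp_ker clr b f.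
  by move=> fk g gb gA; have [c ->] := kspan b g gb gA; rewrite ipZr fk mulr0.
have card_classes b : #|colour_class clr (~~ b)| = #|colour_class clr b| by case: b.
have kform b f fb fk := form b f fb (perp b f fk).
have kform_eq b f fb fk := form_eq b f fb (perp b f fk).
(* Twin leaves are sought in the class [true] only, since their absence from that class is already
   contradictory. *)
have [/existsP [y1 /existsP [y2 /existsP [w]]]|no_twins] := boolP [exists y1, exists y2,
    exists w, [&& clr y1, y1 != y2, degree y1 == 1%N, degree y2 == 1%N, adj y1 w & adj y2 w]].
  move=> /and5P [y1b y12 /eqP d1 /eqP d2 /andP [a1 a2]].
  have [h [c1 [c2 [dh [hw hc1 hc2] [wc1 wc2 c12] [dc1 dc2] wE]]]] :=
    twin_structure Ta Tc clr_adj k0 kb kspan kform kform_eq card_classes degree_sum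
      y1b y12 d1 d2 a1 a2.
  apply: (Y_recognition Tc wE (degree3P dh hw hc1 hc2 wc1 wc2 c12) d1 d2 dc1 dc2 _ c12).
  by split=> //; apply/eqP=> E; move: dh; rewrite -E ?d1 ?d2.
case: (no_twins_false Ta Tc clr_adj k0 kb kA kform_eq card_classes degree_sum
  (b := true) _ t0).
move=> y1 y2 w y1b d1 d2 a1 a2; apply/eqP; apply: contraNT no_twins => y12.
apply/existsP; exists y1; apply/existsP; exists y2; apply/existsP; exists w.
by rewrite y1b y12 d1 d2 a1 a2.
Qed.
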